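(* Let $n\ge1$, $1<r<p<\infty$ and let $X$ be a Banach space such that $$\mathcal{P}_{as(\frac pn;p)}(^nX;l_p)=\mathcal{P}_{as(\frac rn;r)}(^nX;l_p).$$ Then, for every Banach space $Y$, $$\mathcal{P}_{as(\frac pn;p)}(^nX;Y)=\mathcal{P}_{as(\frac1n;1)}(^nX;Y).$$
   Context: All spaces are Banach spaces over $\mathbb{K}=\mathbb{R}$ or $\mathbb{C}$; $l_p$ is the usual scalar sequence space. For $0<p<\infty$, $l_p(E)$ is the space of sequences $(x_j)$ in $E$ with $\sum_j\|x_j\|^p<\infty$, and $l_p^w(E)$ is the space of sequences $(x_j)$ in $E$ with $\sum_j|\varphi(x_j)|^p<\infty$ for every $\varphi\in E'$. For $s,t>0$, $\mathcal{P}_{as(s;t)}(^nE;F)$ denotes the space of continuous $n$-homogeneous polynomials $P:E\to F$ which are absolutely $(s;t)$-summing at the origin, i.e. $(P(x_j))_j\in l_s(F)$ whenever $(x_j)_j\in l_t^w(E)$. *)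

(* Defs.v *)
From HB Require Import structures.
From mathcomp Require Import all_boot all_order all_algebra.
From mathcomp Require Import complex.
From mathcomp Require Import all_classical all_reals all_analysis.

Set Implicit Arguments.
Unset Strict Implicit.
Unset Printing Implicit Defensive.

Import Order.TTheory GRing.Theory Num.Theory.
Import numFieldNormedType.Exports.

Local Open Scope classical_set_scope.
Local Open Scope ring_scope.

Variant scalar_kind := RealScalars | ComplexScalars.

Definition scalars (R : realType) (k : scalar_kind) : numFieldType :=
  match k with
  | RealScalars => R
  | ComplexScalars => (R[i] : numFieldType)
  end.

Definition scal_of_real (R : realType) (k : scalar_kind) : R -> scalars R k :=
  match k return R -> scalars R k with
  | RealScalars => fun a => a
  | ComplexScalars => fun a => real_complex R a
  end.

Definition real_of_scal (R : realType) (k : scalar_kind) : scalars R k -> R :=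
  match k return scalars R k -> R with
  | RealScalars => fun a => a
  | ComplexScalars => @complex.Re R
  end.

Lemma real_of_scal_ge0 (R : realType) (k : scalar_kind) (a : scalars R k) :
  0 <= a -> 0 <= real_of_scal a.
Proof. by case: k a => //= a; rewrite lecE => /andP[]. Qed.

Lemma real_of_scalK (R : realType) (k : scalar_kind) (a : scalars R k) :
  0 <= a -> scal_of_real k (real_of_scal a) = a.
Proof. by case: k a => //= a a0; apply: RRe_real; exact: ger0_real. Qed.

Lemma real_of_scal_le (R : realType) (k : scalar_kind) (a b : scalars R k) :
  a <= b -> real_of_scal a <= real_of_scal b.
Proof. by case: k a b => //= a b; rewrite lecE => /andP[]. Qed.

Lemma scal_of_real_le (R : realType) (k : scalar_kind) (a b : R) :
  a <= b -> scal_of_real k a <= scal_of_real k b.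
Proof. by case: k => //=; rewrite lecR. Qed.

Lemma real_of_scalD (R : realType) (k : scalar_kind) (a b : scalars R k) :
  real_of_scal (a + b) = real_of_scal a + real_of_scal b.
Proof. by case: k a b => //= -[? ?] [? ?]. Qed.

Lemma scal_of_realD (R : realType) (k : scalar_kind) (a b : R) :
  scal_of_real k (a + b) = scal_of_real k a + scal_of_real k b.
Proof. by case: k => //=; exact: rmorphD. Qed.

Lemma scal_of_realM (R : realType) (k : scalar_kind) (a b : R) :
  scal_of_real k (a * b) = scal_of_real k a * scal_of_real k b.
Proof. by case: k => //=; exact: rmorphM. Qed.

Lemma scal_of_realK (R : realType) (k : scalar_kind) (a : R) :
  real_of_scal (scal_of_real k a) = a.
Proof. by case: k. Qed.

Section Scalars.
Variables (R : realType) (k : scalar_kind).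
Local Notation K := (scalars R k).

(* The norm of a normed module over [K] takes its values in [K]; [rnorm] reads it
   back in [R], where real powers are available. *)
Definition rnorm (E : normedModType K) (x : E) : R := real_of_scal `|x|.

Definition abs_summable (s : R) (E : normedModType K) (x : nat -> E) : Prop :=
  (\sum_(j <oo) (rnorm (x j) `^ s)%:E < +oo)%E.

Definition weakly_summable (t : R) (E : normedModType K) (x : nat -> E) : Prop :=
  forall phi : {linear E -> K^o}, continuous phi ->
    abs_summable t (fun j => phi (x j)).

Lemma rnorm_ge0 (E : normedModType K) (x : E) : 0 <= rnorm x.
Proof. exact: real_of_scal_ge0. Qed.

Lemma rnormE (E : normedModType K) (x : E) : scal_of_real k (rnorm x) = `|x|.
Proof. exact: real_of_scalK. Qed.

Lemma rnormD (E : normedModType K) (x y : E) :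
  rnorm (x + y) <= rnorm x + rnorm y.
Proof.
by rewrite /rnorm -real_of_scalD; apply: real_of_scal_le; exact: ler_normD.
Qed.

Lemma rnormZ (E : normedModType K) (a : K^o) (x : E) :
  rnorm (a *: x) = rnorm a * rnorm x.
Proof.
apply: (can_inj (@scal_of_realK R k)).
by rewrite scal_of_realM !rnormE normrZ.
Qed.

Lemma rnorm0 (E : normedModType K) : rnorm (0 : E) = 0.
Proof. by rewrite /rnorm normr0; case: k. Qed.

Lemma rnorm_eq0 (E : normedModType K) (x : E) : rnorm x = 0 -> x = 0.
Proof.
move=> x0; apply/normr0_eq0; rewrite -rnormE x0.
by rewrite -(rnorm0 E) rnormE normr0.
Qed.

Section LpSpace.
Variables (p : R) (p1 : 1 <= p).

Let p_gt0 : 0 < p. Proof. exact: lt_le_trans p1. Qed.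

Let sump (x : nat -> K) : \bar R :=
  (\sum_(j <oo) (rnorm (x j : K^o) `^ p)%:E)%E.

Let lnorm (x : nat -> K) : \bar R := (sump x `^ p^-1)%E.

Let sump_ge0 x : (0 <= sump x)%E.
Proof. by apply: nneseries_ge0 => *; rewrite lee_fin powR_ge0. Qed.

Let lnorm_Lnorm x :
  lnorm x = ('N[counting]_p%:E [EFin \o (fun j => rnorm (x j : K^o))])%E.
Proof.
rewrite Lnorm_counting// /lnorm /sump; congr (_ `^ _)%E.
by apply: eq_eseriesr => j _ /=; rewrite ger0_norm ?rnorm_ge0.
Qed.

Let lnormD x y : (lnorm (x + y)%R <= lnorm x + lnorm y)%E.
Proof.
rewrite !lnorm_Lnorm; apply: le_trans; last first.
  by apply: minkowski_EFin.
rewrite !Lnorm_counting//; apply: gt0_ler_poweR; rewrite ?invr_ge0 ?(ltW p_gt0)//.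
- rewrite in_itv/= leey andbT.
  by apply: nneseries_ge0 => *; rewrite ?lee_fin powR_ge0.
- rewrite in_itv/= leey andbT.
  by apply: nneseries_ge0 => *; rewrite ?lee_fin powR_ge0.
apply: lee_nneseries => [*|j _]; first by rewrite lee_fin powR_ge0.
rewrite /= !ger0_norm ?addr_ge0 ?rnorm_ge0//.
rewrite lee_fin ge0_ler_powR ?nnegrE ?addr_ge0 ?rnorm_ge0 ?(ltW p_gt0)//.
exact: (@rnormD K^o).
Qed.

Let sumpZ (a : K) x :
  sump (a *: x) = ((rnorm (a : K^o) `^ p)%:E * sump x)%E.
Proof.
rewrite /sump -nneseriesZl; last by move=> *; rewrite lee_fin powR_ge0.
apply: eq_eseriesr => j _.
by rewrite (@rnormZ K^o) powRM ?rnorm_ge0// EFinM.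
Qed.

Let sump_fin x : (sump x < +oo)%E -> sump x \is a fin_num.
Proof. by move=> xoo; rewrite ge0_fin_numE. Qed.

Let lnorm_lty x : (lnorm x < +oo)%E = (sump x < +oo)%E.
Proof.
by apply/idP/idP; [apply: lty_poweRy; rewrite invr_eq0 gt_eqF|exact: poweR_lty].
Qed.

(* The (unused) proof that [1 <= p] is recorded in the type [lp p1], so that its
   normed module structure can be inferred. *)
Definition lp_seq of 1 <= p : {pred nat -> K} :=
  mem [set x : nat -> K | abs_summable p (x : nat -> K^o)].

Fact lp_seq_submod_closed : submod_closed (lp_seq p1).
Proof.
split.
  rewrite inE /= /abs_summable eseries0 ?ltry// => j _ _.
  by rewrite (rnorm0 K^o) powR0// gt_eqF.
move=> a x y; rewrite !inE /= /abs_summable.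
rewrite -/(sump x) -/(sump y) -/(sump (a *: x + y)) => xoo yoo.
rewrite -lnorm_lty (le_lt_trans (lnormD _ _))// lte_add_pinfty// lnorm_lty//.
by rewrite sumpZ lte_mul_pinfty// lee_fin powR_ge0.
Qed.

HB.instance Definition _ :=
  GRing.isSubmodClosed.Build K (nat -> K) (lp_seq p1) lp_seq_submod_closed.

Record lp : Type := Lp { lp_val :> nat -> K; lp_valP : lp_val \in (lp_seq p1) }.

HB.instance Definition _ := [isSub for lp_val].
HB.instance Definition _ := [Choice of lp by <:].
HB.instance Definition _ := [SubChoice_isSubLmodule of lp by <:].

Definition lp_norm (x : lp) : K :=
  scal_of_real k
    (fine (\sum_(j <oo) (rnorm (x j : K^o) `^ p)%:E)%E `^ p^-1).

Let lp_normE (x : lp) : lp_norm x = scal_of_real k (fine (lnorm x)).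
Proof.
rewrite /lp_norm -[(\sum_(j <oo) _)%E]/(sump x) /lnorm; congr (scal_of_real k).
have: (sump x < +oo)%E by have := lp_valP x; rewrite inE.
by case: (sump x) (sump_ge0 x).
Qed.

Let lnorm_fin (x : lp) : lnorm x \is a fin_num.
Proof.
rewrite ge0_fin_numE ?poweR_ge0// lnorm_lty.
by have := lp_valP x; rewrite inE.
Qed.

Fact lp_normD (x y : lp) : lp_norm (x + y) <= lp_norm x + lp_norm y.
Proof.
rewrite !lp_normE -scal_of_realD; apply: scal_of_real_le.
by rewrite -fineD ?lnorm_fin// fine_le ?fin_numD ?lnorm_fin// lnormD.
Qed.

Fact lp_normZ (a : K) (x : lp) : lp_norm (a *: x) = `|a| * lp_norm x.
Proof.
rewrite /lp_norm -[(\sum_(j <oo) _)%E]/(sump (a *: (x : nat -> K))).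
rewrite sumpZ -[(\sum_(j <oo) _)%E]/(sump x).
have xfin : sump x \is a fin_num.
  by apply: sump_fin; have := lp_valP x; rewrite inE.
rewrite fineM//= powRM ?powR_ge0 ?fine_ge0// -powRrM divff ?gt_eqF//.
by rewrite powRr1 ?rnorm_ge0// scal_of_realM (rnormE (a : K^o)).
Qed.

Fact lp_norm_eq0 (x : lp) : lp_norm x = 0 -> x = 0.
Proof.
move/(congr1 (@real_of_scal R k)).
rewrite /lp_norm scal_of_realK -[(\sum_(j <oo) _)%E]/(sump x) => h.
have {}h : fine (sump x) = 0.
  by apply: powR_eq0_eq0; apply: etrans h _; rewrite /real_of_scal; case: (k).
have xfin : sump x \is a fin_num.
  by apply: sump_fin; have := lp_valP x; rewrite inE.
have {}h : sump x = 0%E by rewrite -(fineK xfin) h.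
apply/val_inj/funext => j /=; apply: (@rnorm_eq0 K^o).
apply: (@powR_eq0_eq0 _ _ p); apply/eqP.
rewrite eq_le powR_ge0 andbT -lee_fin -[leRHS]h /sump.
have pos i : true -> (0 <= (rnorm (x i : K^o) `^ p)%:E)%E.
  by rewrite lee_fin powR_ge0.
rewrite (@nneseriesD1 R _ j xpredT pos)//; apply: leeDl.
by apply: nneseries_ge0 => i _ _; exact: pos.
Qed.

HB.instance Definition _ :=
  Lmodule_isNormed.Build K lp lp_normD lp_normZ lp_norm_eq0.

End LpSpace.

(* [dfwith x i u] is [x] with its [i]-th entry replaced by [u]. *)
Definition multilinear_map (n : nat) (E F : lmodType K)
    (A : ('I_n -> E) -> F) : Prop :=
  forall (x : 'I_n -> E) (i : 'I_n), linear (fun u : E => A (dfwith x i u)).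

Definition homogeneous_polynomial (n : nat) (E F : lmodType K)
    (P : E -> F) : Prop :=
  exists2 A : ('I_n -> E) -> F,
    multilinear_map A & forall x, P x = A (fun=> x).

(* Absolutely (s;t)-summing at the origin. For [s > 0] the convention
   [0 `^ s = 0] makes [abs_summable] the usual condition. *)
Definition Pas (s t : R) (n : nat) (E F : normedModType K) : set (E -> F) :=
  [set P | [/\ homogeneous_polynomial n P, continuous P &
    forall x : nat -> E, weakly_summable t x ->
      abs_summable s (fun j => P (x j))]].

End Scalars.

Arguments lp {R} k {p} p1.
Arguments Pas {R k} s t n E F.

(* Main.v *)
Require Import Defs.
From HB Require Import structures.
From mathcomp Require Import all_boot all_order all_algebra.
From mathcomp Require Import complex.
From mathcomp Require Import all_classical all_reals all_analysis.
From mathcomp Require Import ring lra.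

(** The proof follows Maurey's extrapolation argument for summing operators, with
    finite means in place of Pietsch measures on the dual ball.

    For [t >= 1], a continuous [n]-homogeneous polynomial [P] is in
    [Pas (t / n) t n] if and only if [x |-> rnorm (P x) `^ (t / n)] satisfies an
    inequality with a uniform constant on all finite families ([Pas_summing], and
    [summing_sequence] for the converse, which rests on uniform boundedness on
    the dual ball).  As that function is homogeneous of degree [t], on any given
    finite family it is dominated by the moments
    [x |-> mu (fun f => rnorm (f x) `^ t)] of a finitely supported mean [mu] on
    the dual ball ([finite_domination]).  All constants are independent of the
    family, so neither compactness nor a limit of the means is required.

    The hypothesis enters as follows.  The [p]-th moments of means are powers of
    norms of operators into [lp], and a sequence of means fits into one operator
    [u] ([lp_operator_of_means]).  To pass from polynomials to operators, multiply
    [u] by powers of a functional [phi]: the result is in [Pas (p / n) p n], hence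
    in [Pas (r / n) r n], and testing it on suitable points shows that [u],
    composed with a projection onto the kernel of [phi], is [r]-summing
    ([linear_factor_summing]).  By a gliding hump over the means, the [p]-th
    moments of all means, to the power [r / p], are [r]-summing with a common
    constant ([moments_summing]).

    Thus each mean can be replaced by another one at the cost of lowering the
    exponent from [p] to [r].  As [1 < r < p], the [r]-th moments interpolate
    between orders [1] and [p], and the part of order [p] is absorbed into the
    left-hand side; this yields a summing inequality for the exponent [1], again
    uniform in the mean ([root_moments_summing]).  Together with the domination
    of polynomials by means this gives one inclusion; the other one is Jensen's
    inequality. *)

Set Implicit Arguments.
Unset Strict Implicit.
Unset Printing Implicit Defensive.

Import Order.TTheory GRing.Theory Num.Theory.
Import numFieldNormedType.Exports.

Local Open Scope classical_set_scope.
Local Open Scope ring_scope.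

(** * Elementary inequalities, finite-dimensional domination and series *)

Section RealInequalities.
Variable R : realType.
Implicit Types a b t : R.

Lemma powR_addl_le a b t : 0 <= a -> 0 <= b -> 0 <= t ->
  (a + b) `^ t <= 2 `^ t * (a `^ t + b `^ t).
Proof.
move=> a0 b0 t0; wlog ab : a b a0 b0 / a <= b => [hw|].
  have [ab|/ltW ba] := leP a b; first exact: hw.
  by rewrite addrC [X in _ * X]addrC; apply: hw.
apply: (@le_trans _ _ ((2 * b) `^ t)).
  by rewrite ge0_ler_powR ?nnegrE//; lra.
by rewrite powRM// ler_wpM2l ?powR_ge0// lerDr powR_ge0.
Qed.

(** Two-term Hoelder, written so that it can be iterated: adding a term to a sum
    or mixing two means only applies it once more. *)
Lemma geometric_mean_superadditive a b (u1 u2 v1 v2 : R) :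
  0 < a -> 0 < b -> a + b = 1 ->
  0 <= u1 -> 0 <= u2 -> 0 <= v1 -> 0 <= v2 ->
  u1 `^ a * v1 `^ b + u2 `^ a * v2 `^ b <= (u1 + u2) `^ a * (v1 + v2) `^ b.
Proof.
move=> a0 b0 ab u10 u20 v10 v20.
have := @hoelder2 R (u1 `^ a) (u2 `^ a) (v1 `^ b) (v2 `^ b) a^-1 b^-1.
rewrite !powR_ge0 !invr_gt0 !invrK -!powRrM !mulfV ?gt_eqF// !powRr1//.
exact.
Qed.

Lemma hoelder_sum (I : Type) (s : seq I) a b (u v : I -> R) :
  0 < a -> 0 < b -> a + b = 1 -> (forall i, 0 <= u i) -> (forall i, 0 <= v i) ->
  \sum_(i <- s) u i `^ a * v i `^ b <=
  (\sum_(i <- s) u i) `^ a * (\sum_(i <- s) v i) `^ b.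
Proof.
move=> a0 b0 ab u0 v0; elim: s => [|i s ih].
  by rewrite !big_nil mulr_ge0// powR_ge0.
rewrite !big_cons; apply: le_trans (geometric_mean_superadditive a0 b0 ab _ _ _ _);
  by rewrite ?lerD2l ?sumr_ge0.
Qed.

End RealInequalities.

Section ConvexDomination.
Variables (R : realType) (I : eqType) (F : seq I).
Variables (C : (I -> R) -> Prop) (a : I -> R) (M : R).
Hypothesis C_nonempty : exists v, C v.
Hypothesis C_convex : forall (c : R) v s, 0 <= c <= 1 -> C v -> C s ->
  C (fun i => c * v i + (1 - c) * s i).
Hypothesis C_bounded : forall v, C v -> forall i, i \in F -> 0 <= v i <= M.
Hypothesis C_support : forall t : I -> R, (forall i, 0 <= t i) ->
  forall eta : R, 0 < eta ->
  exists2 v, C v & \sum_(i <- F) t i * a i <= \sum_(i <- F) t i * v i + eta.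

Let gap (v : I -> R) i := Num.max 0 (a i - v i).
Let sqdist (v : I -> R) := \sum_(i <- F) gap v i ^+ 2.

Let gap_ge0 v i : 0 <= gap v i. Proof. by rewrite /gap le_max lexx. Qed.

Let gapM v i : gap v i * (a i - v i) = gap v i ^+ 2.
Proof. by rewrite /gap; case: leP => _; rewrite ?mul0r ?expr0n// expr2. Qed.

Let sqdist_ge0 v : 0 <= sqdist v.
Proof. by apply: sumr_ge0 => i _; rewrite sqr_ge0. Qed.

Let L := \sum_(i <- F) M ^+ 2.

Let L_ge0 : 0 <= L.
Proof. by apply: sumr_ge0 => i _; exact: sqr_ge0. Qed.

(** Gradient descent: by [C_support] some [s] in [C] makes the functional [gap v]
    almost as large as [a] does, and moving from [v] towards [s] decreases the
    distance to first order. *)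
Let descent v (c eta : R) : C v -> 0 <= c <= 1 -> 0 < eta ->
  exists2 v', C v' & sqdist v' <= (1 - 2 * c) * sqdist v + 2 * c * eta + c ^+ 2 * L.
Proof.
move=> Cv c01 eta0; have [s Cs hs] := C_support (gap_ge0 v) eta0.
exists (fun i => c * s i + (1 - c) * v i); first exact: C_convex.
have step : sqdist (fun i => c * s i + (1 - c) * v i) <=
    \sum_(i <- F) (gap v i + c * (v i - s i)) ^+ 2.
  apply: ler_sum => i _.
  have h : a i - (c * s i + (1 - c) * v i) <= gap v i + c * (v i - s i).
    have : a i - v i <= gap v i by rewrite /gap le_max lexx orbT.
    lra.
  rewrite {1}/gap; case: (leP 0 (a i - _)) => h0; last by rewrite expr0n sqr_ge0.
  by rewrite lerXn2r// nnegrE; exact: le_trans h0 h.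
apply: (le_trans step).
have expand : \sum_(i <- F) (gap v i + c * (v i - s i)) ^+ 2 =
    sqdist v + 2 * c * (\sum_(i <- F) gap v i * a i - sqdist v -
      \sum_(i <- F) gap v i * s i) + c ^+ 2 * \sum_(i <- F) (v i - s i) ^+ 2.
  rewrite /sqdist -!sumrB !mulr_sumr -!big_split/=; apply: eq_bigr => i _.
  have h : gap v i * v i = gap v i * a i - gap v i ^+ 2 by rewrite -gapM; ring.
  transitivity (gap v i ^+ 2 + 2 * c * (gap v i * v i - gap v i * s i) +
    c ^+ 2 * (v i - s i) ^+ 2); first by ring.
  by rewrite h; ring.
have quad : \sum_(i <- F) (v i - s i) ^+ 2 <= L.
  rewrite /L !big_seq; apply: ler_sum => i iF.
  have /andP[v0 vM] := C_bounded Cv iF; have /andP[s0 sM] := C_bounded Cs iF.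
  by rewrite -subr_ge0 subr_sqr mulr_ge0//; lra.
rewrite expand; have /andP[c0 c1] := c01.
have := ler_wpM2l (sqr_ge0 c) quad.
have : 2 * c * (\sum_(i <- F) gap v i * a i - sqdist v - \sum_(i <- F) gap v i * s i)
   <= 2 * c * (eta - sqdist v) by rewrite ler_wpM2l//; lra.
lra.
Qed.

Let sqdist_small (e : R) : 0 < e -> exists2 v, C v & sqdist v < e.
Proof.
move=> e0; pose S := [set sqdist v | v in [set v | C v]].
have Slb : has_inf S.
  split; first by case: C_nonempty => v Cv; exists (sqdist v), v.
  by exists 0 => _ [v _ <-]; exact: sqdist_ge0.
suff h : inf S < e.
  have [] := @inf_adherent _ S (e - inf S) _ Slb; first by rewrite subr_gt0.
  by move=> _ [v Cv <-]; rewrite addrC subrK => ve; exists v.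
rewrite (le_lt_trans _ e0)// leNgt; apply/negP => d0.
set d := inf S in d0; have L0 := L_ge0.
(* a step length for which the quadratic error is beaten by the linear gain *)
pose c := d / (4 * d + 4 * L + 4 * 1).
have D0 : 0 < 4 * d + 4 * L + 4 * 1 by lra.
have c0 : 0 < c by rewrite divr_gt0.
have cD : c * (4 * d + 4 * L + 4 * 1) = d by rewrite /c divfK// gt_eqF.
have cd : 0 < c * d by rewrite mulr_gt0.
have cL : 0 <= c * L by rewrite mulr_ge0// ltW.
have c1 : c <= 1/4 by rewrite /c ler_pdivrMr//; lra.
have [] := @inf_adherent _ S (c * d / 2) _ Slb; first by rewrite divr_gt0.
move=> _ [v Cv <-]; rewrite -/d => hv.
have d4 : 0 < d / 4 by rewrite divr_gt0.
have c01 : 0 <= c <= 1 by rewrite (ltW c0); lra.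
have [v' Cv' hv'] := descent Cv c01 d4.
have : d <= sqdist v' by apply: inf_lbound => //; [case: Slb|exists v'].
have : (1 - 2 * c) * sqdist v <= (1 - 2 * c) * (d + c * d / 2).
  by rewrite ler_wpM2l//; lra.
have : c ^+ 2 * L <= c * d / 4.
  by rewrite expr2 -mulrA -[in leRHS]mulrA ler_wpM2l ?ltW//; lra.
have : 0 <= c * (c * d) by rewrite mulr_ge0// ltW.
by rewrite !expr2 in hv' *; lra.
Qed.

(** A finite-dimensional separation argument without separation theorem: if no
    nonnegative functional separates [a] from the convex set [C], then the
    distance from [C] to the points above [a] vanishes, since gradient descent
    could decrease a positive one.  The factor 2 turns the additive error into
    a multiplicative one. *)
Lemma convex_domination : exists2 v, C v & forall i, i \in F -> a i <= 2 * v i.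
Proof.
have [e e0 he] : exists2 e, 0 < e & forall i, i \in F -> 0 < a i ->
    e <= (a i / 2) ^+ 2.
  elim: F => [|i s [e e0 he]]; first by exists 1; rewrite ?ltr01.
  exists (if 0 < a i then Num.min e ((a i / 2) ^+ 2) else e).
    by case: ifPn => // ai; rewrite lt_min e0 exprn_gt0// divr_gt0.
  move=> j; rewrite inE => /orP[/eqP->|js] aj.
    by rewrite aj ge_min lexx orbT.
  by case: ifPn => _; [rewrite ge_min (he _ js aj)|exact: he js aj].
have [v Cv hv] := sqdist_small e0; exists v => // i iF.
have /andP[v0 _] := C_bounded Cv iF.
have [ai|ai] := ltP 0 (a i); last by lra.
rewrite leNgt; apply/negP => h.
have : sqdist v < (a i / 2) ^+ 2 by exact: lt_le_trans hv (he _ iF ai).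
apply/negP; rewrite -leNgt.
apply: (@le_trans _ _ (gap v i ^+ 2)).
  rewrite lerXn2r// ?nnegrE; [lra|exact: gap_ge0|].
  by rewrite /gap le_max; apply/orP; right; lra.
rewrite /sqdist (perm_big _ (perm_to_rem iF))/= big_cons lerDl.
by apply: sumr_ge0 => j _; exact: sqr_ge0.
Qed.

End ConvexDomination.

Section Series.
Variable R : realType.

Lemma nneseries_le_partial (u : nat -> R) (W : R) : (forall i, 0 <= u i) ->
  (forall m, \sum_(j < m) u j <= W) -> (\sum_(j <oo) (u j)%:E <= W%:E)%E.
Proof.
move=> u0 h; apply: lime_le.
  by apply: is_cvg_nneseries => i _ _; rewrite lee_fin.
by near=> m; rewrite sumEFin lee_fin big_mkord.
Unshelve. all: by end_near. Qed.

Lemma partial_le_nneseries (u : nat -> R) (m : nat) : (forall i, 0 <= u i) ->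
  ((\sum_(j < m) u j)%:E <= \sum_(j <oo) (u j)%:E)%E.
Proof.
move=> u0; rewrite -sumEFin -(big_mkord xpredT (fun j => (u j)%:E)).
by apply: nneseries_lim_ge => i _ _; rewrite lee_fin.
Qed.

Lemma term_le_nneseries (u : nat -> \bar R) (j : nat) : (forall i, 0 <= u i)%E ->
  (u j <= \sum_(i <oo) u i)%E.
Proof.
move=> u0; rewrite (@nneseriesD1 R _ j xpredT)//.
by apply: leeDl; apply: nneseries_ge0.
Qed.

(** Enumerating pairs of indices turns a double series into a simple one; it is
    how a sequence of finite families is concatenated. *)
Lemma nneseries_pairing : exists e : nat -> nat * nat,
  forall h : nat * nat -> \bar R, (forall z, 0 <= h z)%E ->
  (\sum_(l <oo) h (e l) = \sum_(k <oo) \sum_(i <oo) h (k, i))%E.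
Proof.
have /card_esym/ppcard_eqP[e] := card_nat2; exists e => h h0.
rewrite nneseries_esumT//.
rewrite -(@reindex_esum R nat _ setT setT e h (@bij _ _ _ _ e)).
have -> : [set: nat * nat] = setT `*`` (fun=> setT).
  by apply/seteqP; split => // -[? ?].
rewrite (_ : h = fun z => h (z.1, z.2)); last by apply/funext => -[].
rewrite -(@esum_esum R nat nat setT (fun=> setT) (fun k i => h (k, i)))//.
rewrite nneseries_esumT => [|k]; last by apply: nneseries_ge0 => i _ _; exact: h0.
by apply: eq_esum => k _; rewrite nneseries_esumT.
Qed.

Lemma nneseries_finite_support (h : nat -> \bar R) (m : nat) :
  (forall i, 0 <= h i)%E -> (forall i, (m <= i)%N -> h i = 0%E) ->
  (\sum_(i <oo) h i = \sum_(i < m) h i)%E.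
Proof.
move=> h0 hm; rewrite (nneseries_split 0%N m) => [|i _]; last exact: h0.
rewrite add0n [X in (_ + X)%E]eseries0 ?adde0 ?big_mkord// => i mi _.
exact: hm.
Qed.

Lemma nneseries_nth (T : Type) (x0 : T) (s : seq T) (h : T -> R) :
  (forall x, 0 <= h x) -> h x0 = 0 ->
  (\sum_(i <oo) (h (nth x0 s i))%:E = (\sum_(x <- s) h x)%:E)%E.
Proof.
move=> h_ge0 h0; rewrite (@nneseries_finite_support _ (size s)) => [|i|i si].
- by rewrite sumEFin (big_nth x0) big_mkord.
- by rewrite lee_fin.
- by rewrite nth_default// h0.
Qed.

End Series.

(** * Finitely supported means *)

Section FiniteMeans.
Variables (R : realType) (D : Type) (B : D -> Prop).
Implicit Types (m : (D -> R) -> R) (f g u v : D -> R).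

(** Expectations with respect to finitely supported probability measures on
    [B].  Being generated by mixing two means at a time, they inherit an
    inequality as soon as it is stable under convex combinations. *)
Inductive finite_mean : ((D -> R) -> R) -> Prop :=
| dirac_mean d of B d : finite_mean (fun f => f d)
| mixed_mean (c : R) m1 m2 of 0 <= c <= 1 & finite_mean m1 & finite_mean m2 :
    finite_mean (fun f => c * m1 f + (1 - c) * m2 f).

Lemma mean_le m f g : finite_mean m -> (forall d, B d -> f d <= g d) ->
  m f <= m g.
Proof.
move=> mm fg; elim: mm => [d /fg//|c m1 m2 /andP[c0 c1] _ h1 _ h2].
by rewrite lerD// ler_wpM2l// subr_ge0.
Qed.

Lemma mean_cst m (c : R) : finite_mean m -> m (fun=> c) = c.
Proof. by elim=> // a m1 m2 _ _ -> _ ->; rewrite -mulrDl addrC subrK mul1r. Qed.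

Lemma mean_ge0 m f : finite_mean m -> (forall d, 0 <= f d) -> 0 <= m f.
Proof. by move=> mm f0; rewrite -(mean_cst 0 mm); exact: mean_le. Qed.

Lemma meanD m f g : finite_mean m -> m (fun d => f d + g d) = m f + m g.
Proof. by elim=> // c m1 m2 _ _ -> _ ->; ring. Qed.

Lemma meanZ m (a : R) f : finite_mean m -> m (fun d => a * f d) = a * m f.
Proof. by elim=> // c m1 m2 _ _ -> _ ->; ring. Qed.

Lemma mean_sum m (I : Type) (s : seq I) (F : I -> D -> R) : finite_mean m ->
  m (fun d => \sum_(i <- s) F i d) = \sum_(i <- s) m (F i).
Proof.
move=> mm; elim: s => [|i s ih].
  rewrite big_nil -[RHS](mean_cst 0 mm); congr (m _).
  by apply/funext => d; rewrite big_nil.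
rewrite big_cons -ih -(meanD _ _ mm); congr (m _).
by apply/funext => d; rewrite big_cons.
Qed.

Lemma mean_hoelder m (a b : R) u v : finite_mean m ->
  0 < a -> 0 < b -> a + b = 1 ->
  (forall d, 0 <= u d) -> (forall d, 0 <= v d) ->
  m (fun d => u d `^ a * v d `^ b) <= m u `^ a * m v `^ b.
Proof.
move=> mm a0 b0 ab u0 v0; elim: mm => // c m1 m2 /andP[c0 c1] mm1 h1 mm2 h2.
have c1' : 0 <= 1 - c by rewrite subr_ge0.
have split (e : R) (x y : R) : 0 <= e -> 0 <= x -> 0 <= y ->
    e * (x `^ a * y `^ b) = (e * x) `^ a * (e * y) `^ b.
  by move=> e0 x0 y0; rewrite !powRM// mulrACA -powRD ?ab ?oner_eq0// powRr1.
apply: (@le_trans _ _ (c * (m1 u `^ a * m1 v `^ b) +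
    (1 - c) * (m2 u `^ a * m2 v `^ b))).
  by rewrite lerD// ler_wpM2l.
rewrite !split ?mean_ge0//; apply: geometric_mean_superadditive => //;
  by rewrite mulr_ge0// mean_ge0.
Qed.

(** Hoelder applied to [f `^ r = f `^ a * (f `^ p) `^ b] where [a + b = 1] and
    [a + p * b = r]. *)
Lemma mean_interpolation m (r p : R) f : finite_mean m -> 1 < r -> r < p ->
  (forall d, 0 <= f d) ->
  m (fun d => f d `^ r) <=
  m f `^ ((p - r) / (p - 1)) * m (fun d => f d `^ p) `^ ((r - 1) / (p - 1)).
Proof.
move=> mm r1 rp f0.
have p1 : 0 < p - 1 by rewrite subr_gt0 (lt_trans r1).
apply: le_trans (mean_hoelder mm _ _ _ f0 (fun d => powR_ge0 _ _)).
- apply: mean_le => // d _; rewrite -powRrM -powRD.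
    suff -> : (p - r) / (p - 1) + p * ((r - 1) / (p - 1)) = r by [].
    by field; exact: lt0r_neq0.
  apply/implyP => /eqP h; exfalso; move: h.
  rewrite (_ : _ + _ = r); last by field; exact: lt0r_neq0.
  by apply/eqP; rewrite gt_eqF// (lt_trans ltr01).
- by rewrite divr_gt0// subr_gt0.
- by rewrite divr_gt0// subr_gt0.
- by field; exact: lt0r_neq0.
Qed.

Lemma mean_powR_le m (p : R) f : finite_mean m -> 1 <= p ->
  (forall d, 0 <= f d) -> m f `^ p <= m (fun d => f d `^ p).
Proof.
move=> mm p1 f0; have p0 : 0 < p by apply: lt_le_trans p1.
elim: mm => // c m1 m2 c01 mm1 h1 mm2 h2.
have /andP[c0 c1] := c01.
apply: (@le_trans _ _ (c * m1 f `^ p + (1 - c) * m2 f `^ p)); last first.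
  by rewrite lerD// ler_wpM2l// subr_ge0.
have nonneg x : 0 <= x -> x \in (`[0, +oo[%classic : set R).
  by move=> x0; rewrite inE/= in_itv/= x0.
exact: (convex_powR p1 (Itv01 c0 c1) (nonneg _ (mean_ge0 mm1 f0))
  (nonneg _ (mean_ge0 mm2 f0))).
Qed.

(** The finite support is padded to an infinite sequence of weight [0], so that
    the coordinates of several means can be indexed by pairs of integers. *)
Lemma mean_series m : finite_mean m -> exists (w : nat -> R) (e : nat -> D),
  [/\ forall i, 0 <= w i, forall i, B (e i) &
   forall f, (forall d, 0 <= f d) ->
     (\sum_(i <oo) (w i * f (e i))%:E)%E = (m f)%:E].
Proof.
have finite : finite_mean m -> exists s : seq (R * D), [/\
    (forall d0, B d0 -> forall i, 0 <= (nth (0, d0) s i).1 /\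
      B (nth (0, d0) s i).2),
    (exists d, B d) & forall f, m f = \sum_(z <- s) z.1 * f z.2].
  elim=> [d Bd|c m1 m2 /andP[c0 c1] _ [s1 [g1 b1 h1]] _ [s2 [g2 b2 h2]]].
    exists [:: (1, d)]; split; [|by exists d|].
      by move=> d0 Bd0 [|[|i]].
    by move=> f; rewrite big_seq1 mul1r.
  pose sc (a : R) (z : R * D) := (a * z.1, z.2).
  exists (map (sc c) s1 ++ map (sc (1 - c)) s2); split => //.
  - move=> d0 Bd0 i; rewrite nth_cat size_map.
    have scaled a s j : 0 <= a -> (forall i, 0 <= (nth (0, d0) s i).1 /\
        B (nth (0, d0) s i).2) ->
        0 <= (nth (0, d0) (map (sc a) s) j).1 /\
        B (nth (0, d0) (map (sc a) s) j).2.
      move=> a0 gs; have [js|js] := ltnP j (size s).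
        by rewrite (nth_map (0, d0))//=; have [? ?] := gs j; rewrite mulr_ge0.
      by rewrite nth_default ?size_map.
    by case: ifPn => _; apply: scaled; rewrite ?subr_ge0//; [exact: g1|exact: g2].
  - move=> f; rewrite big_cat/= !big_map/= h1 h2 !mulr_sumr.
    by congr (_ + _); apply: eq_bigr => z _; rewrite mulrA.
move=> mm; have [s [gs [d0 Bd0] hs]] := finite mm.
exists (fun i => (nth (0, d0) s i).1), (fun i => (nth (0, d0) s i).2).
split=> [i|i|f f0]; try by have [] := gs _ Bd0 i.
rewrite (nneseries_split 0%N (size s)) => [|i _]; last first.
  by rewrite lee_fin mulr_ge0//; have [] := gs _ Bd0 i.
rewrite add0n [X in (_ + X)%E]eseries0 => [|i si _]; last first.
  by rewrite nth_default//= mul0r.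
by rewrite adde0 sumEFin hs (big_nth (0, d0)).
Qed.

End FiniteMeans.

(** * Completeness of the scalar fields *)

Section GeometricLimit.
Variable R : realType.

(** Small enough for the tail of a geometric series to be negligible against the
    term preceding it, even after taking [t]-th powers with [t >= 1]. *)
Definition ratio : R := 64^-1.

Lemma ratio_exp_gt0 i : 0 < ratio ^+ i.
Proof. by rewrite exprn_gt0// invr_gt0. Qed.

Lemma le_ratio_exp_eq0 (v c : R) : 0 <= v -> (forall i, v <= c * ratio ^+ i) ->
  v = 0.
Proof.
move=> v0 h; apply/eqP; rewrite eq_le v0 andbT.
have : c * ratio ^+ i @[i --> \oo] --> c * 0.
  apply: cvgMr; apply: cvg_expr.
  by rewrite ger0_norm ?invr_ge0// /ratio; lra.
rewrite mulr0 => hc; rewrite -(cvg_lim _ hc)//.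
by apply: limr_ge; [apply/cvg_ex; exists 0|apply: nearW].
Qed.

(** The intervals of centre [z i] and radius [2 * c * ratio ^+ i] are nested; any
    point common to all of them will do. *)
Lemma real_geometric_limit (z : nat -> R) (c : R) :
  (forall i, `|z i.+1 - z i| <= c * ratio ^+ i) ->
  exists l, forall i, `|l - z i| <= 2 * c * ratio ^+ i.
Proof.
move=> hz; pose d i := 2 * c * ratio ^+ i.
have dS i : d i.+1 = d i / 64 by rewrite /d exprSr mulrA.
have c0 i : 0 <= d i.
  have := le_trans (normr_ge0 _) (hz i); rewrite /d; lra.
have z_step i : `|z i.+1 - z i| <= d i / 2.
  by apply: le_trans (hz i) _; rewrite /d; lra.
have lo : {homo (fun i => z i - d i) : i j / (i <= j)%N >-> i <= j}.
  apply/nondecreasing_seqP => i; have := z_step i; rewrite ler_norml => /andP[].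
  have := c0 i; rewrite dS; lra.
have hi : {homo (fun i => z i + d i) : i j / (i <= j)%N >-> j <= i}.
  apply/nonincreasing_seqP => i; have := z_step i; rewrite ler_norml => /andP[].
  have := c0 i; rewrite dS; lra.
have nested i j : z i - d i <= z j + d j.
  have h1 := lo _ _ (leq_maxl i j); have h2 := hi _ _ (leq_maxr i j).
  rewrite (le_trans h1)// (le_trans _ h2)//; have := c0 (maxn i j); lra.
pose S := [set z i - d i | i in [set: nat]].
exists (sup S) => i; rewrite -/(d i) ler_distl; apply/andP; split.
  apply: sup_upper_bound; last by exists i.
  split; first by exists (z 0%N - d 0%N), 0%N.
  by exists (z 0%N + d 0%N) => _ [j _ <-].
by apply: ge_sup; [exists (z 0%N - d 0%N), 0%N|move=> _ [j _ <-]].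
Qed.

Lemma rnormN (k : scalar_kind) (E : normedModType (scalars R k)) (x : E) :
  rnorm (- x) = rnorm x.
Proof. by rewrite /rnorm normrN. Qed.

Lemma rnormB_le (k : scalar_kind) (E : normedModType (scalars R k)) (x y : E) :
  rnorm (x - y) <= rnorm x + rnorm y.
Proof. by rewrite -(rnormN y); exact: rnormD. Qed.

Lemma rnorm_scal_of_real (k : scalar_kind) (a : R) : 0 <= a ->
  rnorm (scal_of_real k a : (scalars R k)^o) = a.
Proof.
move=> a0; rewrite /rnorm ger0_norm ?scal_of_realK//.
by have := scal_of_real_le k a0; congr (_ <= _); case: k.
Qed.

(** Completeness of both scalar fields, in the form needed to define the pointwise
    limit of a sequence of functionals. *)
Lemma geometric_limit (k : scalar_kind) (z : nat -> (scalars R k)^o) (c : R) :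
  (forall i, rnorm (z i.+1 - z i) <= c * ratio ^+ i) ->
  exists l, forall i, rnorm (l - z i) <= 4 * c * ratio ^+ i.
Proof.
case: k z => /= z hz.
  have [l hl] := real_geometric_limit hz; exists l => i.
  apply: le_trans (hl i) _.
  have := le_trans (normr_ge0 _) (hz i); lra.
have normE (a : scalars R ComplexScalars) :
    rnorm (a : (scalars R ComplexScalars)^o) =
    Num.sqrt (complex.Re a ^+ 2 + complex.Im a ^+ 2).
  by rewrite /rnorm normc_def.
have Re_le (a : scalars R ComplexScalars) :
    `|complex.Re a| <= rnorm (a : (scalars R ComplexScalars)^o).
  by rewrite normE -sqrtr_sqr ler_wsqrtr// lerDl sqr_ge0.
have Im_le (a : scalars R ComplexScalars) :
    `|complex.Im a| <= rnorm (a : (scalars R ComplexScalars)^o).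
  by rewrite normE -sqrtr_sqr ler_wsqrtr// lerDr sqr_ge0.
have le_ReIm (a : scalars R ComplexScalars) :
    rnorm (a : (scalars R ComplexScalars)^o) <= `|complex.Re a| + `|complex.Im a|.
  rewrite normE -ler_sqr ?nnegrE ?sqrtr_ge0 ?addr_ge0//.
  rewrite sqr_sqrtr ?addr_ge0 ?sqr_ge0//.
  rewrite sqrrD !real_normK ?num_real// addrAC lerDl.
  by rewrite mulrn_wge0 ?mulr_ge0.
have ReB (a b : scalars R ComplexScalars) :
    complex.Re (a - b) = complex.Re a - complex.Re b.
  by case: a b => [? ?] [? ?].
have ImB (a b : scalars R ComplexScalars) :
    complex.Im (a - b) = complex.Im a - complex.Im b.
  by case: a b => [? ?] [? ?].
have [|a ha] := @real_geometric_limit (fun i => complex.Re (z i)) c.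
  by move=> i; apply: le_trans (hz i); rewrite -ReB; exact: Re_le.
have [|b hb] := @real_geometric_limit (fun i => complex.Im (z i)) c.
  by move=> i; apply: le_trans (hz i); rewrite -ImB; exact: Im_le.
exists (complex.Complex a b) => i; apply: le_trans (le_ReIm _) _.
by rewrite ReB ImB; apply: le_trans (lerD (ha i) (hb i)) _; lra.
Qed.
End GeometricLimit.

(** * Functionals and uniform boundedness *)

Section Functionals.
Variables (R : realType) (k : scalar_kind).
Local Notation K := (scalars R k).
Implicit Types (E : normedModType K).

Lemma le_scal_of_real (a b : R) : (scal_of_real k a <= scal_of_real k b) = (a <= b).
Proof. by case: k => //=; exact: lecR. Qed.

Lemma lt_scal_of_real (a b : R) : (scal_of_real k a < scal_of_real k b) = (a < b).
Proof. by case: k => //=; exact: ltcR. Qed.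

Lemma continuous_bounded E (F : normedModType K) (f : {linear E -> F}) :
  continuous f -> exists2 c : R, 0 < c & forall x, rnorm (f x) <= c * rnorm x.
Proof.
move/linear_bounded_continuous/linear_boundedP => [M [Mreal hM]].
pose c := rnorm (M : K^o) + 1.
have c0 : 0 < c by rewrite ltr_wpDl ?rnorm_ge0.
exists c => // x; have Mc : M < scal_of_real k c.
  rewrite (le_lt_trans (real_ler_norm Mreal))// -[ltLHS](rnormE (M : K^o)).
  by rewrite lt_scal_of_real ltrDl.
have := hM _ Mc x; rewrite -!rnormE -scal_of_realM.
by rewrite le_scal_of_real.
Qed.

Lemma bounded_continuous E (F : normedModType K) (f : {linear E -> F}) (c : R) :
  (forall x, rnorm (f x) <= c * rnorm x) -> continuous f.
Proof.
move=> h; apply/linear_bounded_continuous/linear_boundedP.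
exists (scal_of_real k c); split.
  by case: (k) => //=; apply/complex_realP; exists c.
move=> r /ltW cr x; rewrite -rnormE -(rnormE x).
apply: (le_trans (scal_of_real_le k (h x))).
rewrite scal_of_realM ler_wpM2r//.
by rewrite rnormE normr_ge0.
Qed.

Definition contraction E (f : E -> K^o) := forall x, rnorm (f x) <= rnorm x.

Lemma contraction_continuous E (f : {linear E -> K^o}) :
  contraction f -> continuous f.
Proof. by move=> h; apply: (@bounded_continuous _ _ _ 1) => x; rewrite mul1r. Qed.

Lemma contraction0 E : contraction (\0 : {linear E -> K^o}).
Proof. by move=> x; rewrite /= (rnorm0 K^o) rnorm_ge0. Qed.

Lemma rescaled_contraction E (f : {linear E -> K^o}) (c : R) : 0 < c ->
  (forall x, rnorm (f x) <= c * rnorm x) ->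
  contraction (scal_of_real k c^-1 \*: f : {linear E -> K^o}).
Proof.
move=> c0 h x; rewrite /= rnormZ rnorm_scal_of_real ?invr_ge0 ?(ltW c0)//.
by rewrite ler_pdivrMl.
Qed.

Lemma functional_limit E (f : nat -> {linear E -> K^o}) :
  (forall i x, rnorm (f i.+1 x - f i x) <= ratio R ^+ i * rnorm x) ->
  exists g : {linear E -> K^o},
    forall i x, rnorm (g x - f i x) <= 4 * ratio R ^+ i * rnorm x.
Proof.
move=> fS.
have lim x : exists l : K^o, forall i,
    rnorm (l - f i x) <= 4 * rnorm x * ratio R ^+ i.
  by apply: (@geometric_limit R k (fun i => f i x)) => i; rewrite mulrC.
have [g hg] := choice lim.
have glin : linear g.
  move=> a x y; apply/eqP; rewrite -subr_eq0; apply/eqP/rnorm_eq0.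
  apply: (@le_ratio_exp_eq0 R _ (4 * rnorm (a *: x + y) +
    rnorm (a : K^o) * (4 * rnorm x) + 4 * rnorm y)) => [|i].
    exact: rnorm_ge0.
  have -> : g (a *: x + y) - (a *: g x + g y) =
      (g (a *: x + y) - f i (a *: x + y)) - a *: (g x - f i x) - (g y - f i y).
    rewrite linearP scalerBr !opprB !opprD -!addrA; congr (_ + _).
    by rewrite addrCA; ring.
  apply: (le_trans (rnormB_le _ _)); rewrite 2!mulrDl; apply: lerD => //.
  apply: (le_trans (rnormB_le _ _)); apply: lerD => //.
  by rewrite rnormZ -mulrA ler_wpM2l// rnorm_ge0.
pose gL := GRing.isLinear.Build K E K^o _ g glin.
exists (HB.pack_for {linear E -> K^o} g gL) => i x /=.
by rewrite mulrAC.
Qed.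

Section UniformBound.
Variables (E : normedModType K) (t : R) (x : nat -> E).
Hypothesis t_ge1 : 1 <= t.

Let N m (f : E -> K^o) : R := \sum_(j < m) rnorm (f (x j)) `^ t.

Let t_ge0 : 0 <= t. Proof. exact: le_trans t_ge1. Qed.

Let N_triangle m (f g h : E -> K^o) :
  (forall y, rnorm (h y) <= rnorm (f y) + rnorm (g y)) ->
  N m h <= 2 `^ t * (N m f + N m g).
Proof.
move=> fgh; rewrite /N -big_split/= mulr_sumr; apply: ler_sum => j _.
apply: le_trans (powR_addl_le _ _ _); rewrite ?rnorm_ge0//.
by rewrite ge0_ler_powR ?nnegrE ?addr_ge0 ?rnorm_ge0.
Qed.

Let N_scale m (f g : E -> K^o) (c : R) : 0 <= c ->
  (forall y, rnorm (g y) = c * rnorm (f y)) -> N m g = c `^ t * N m f.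
Proof.
move=> c0 h; rewrite /N mulr_sumr; apply: eq_bigr => j _.
by rewrite h powRM// rnorm_ge0.
Qed.

Let sup_N m : has_ubound [set N m f | f in
  [set f : {linear E -> K^o} | contraction f]].
Proof.
exists (\sum_(j < m) rnorm (x j) `^ t) => _ [f cf <-].
apply: ler_sum => j _.
by rewrite ge0_ler_powR ?nnegrE ?rnorm_ge0.
Qed.

Let near_norming (W : R) : 0 <= W ->
  (forall W, exists f : {linear E -> K^o}, exists2 m,
    contraction f & W < N m f) ->
  exists d : nat * R * {linear E -> K^o},
  [/\ contraction d.2, W < d.1.2, d.1.2 / 2 <= N d.1.1 d.2 &
    forall f : {linear E -> K^o}, contraction f -> N d.1.1 f <= d.1.2].
Proof.
move=> W0 /(_ W)[f [m cf Wf]].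
pose A := [set N m f | f in [set f : {linear E -> K^o} | contraction f]].
have supA : has_sup A by split; [exists (N m f), f|exact: sup_N].
have SW : W < sup A.
  by apply: lt_le_trans Wf _; apply: sup_upper_bound => //; exists f.
have S0 : 0 < sup A / 2 by rewrite divr_gt0// (le_lt_trans W0).
have [_ [g cg <-] hg] := sup_adherent S0 supA.
exists (m, sup A, g); split => //=; first by lra.
by move=> h ch; apply: sup_upper_bound => //; exists h.
Qed.

(** Uniform boundedness on the dual ball, by a gliding hump without Baire
    category.  If the sums were not uniformly bounded, add up functionals that
    almost attain larger and larger suprema [S i], with geometrically decreasing
    coefficients.  Choosing the sign of each coefficient prevents the new term
    from being cancelled by the preceding ones, the following ones are too small
    to matter, and the limit functional contradicts weak summability. *)
Lemma weakly_summable_bounded : weakly_summable t x ->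
  exists W, forall f : {linear E -> K^o}, contraction f -> forall m,
    \sum_(j < m) rnorm (f (x j)) `^ t <= W.
Proof.
move=> wx; apply: contrapT => unbounded.
have {}unbounded W : exists f : {linear E -> K^o}, exists2 m,
    contraction f & W < N m f.
  apply: contrapT => h; apply: unbounded; exists W => f cf m.
  by rewrite leNgt; apply/negP => Wm; apply: h; exists f, m.
pose rho i := ratio R ^+ i.
have rho0 i : 0 < rho i := ratio_exp_gt0 R i.
(* [S i] is taken so large that [i] survives the division by [c i] and by [8] *)
pose c i := 2 `^ t * (rho i)^-1 `^ t.
have c0 i : 0 < c i by rewrite mulr_gt0// powR_gt0// invr_gt0.
have W0 i : 0 <= 8 * (c i * i%:R) by rewrite mulr_ge0// mulr_ge0// ltW.
have [d hd] := choice (fun i => near_norming (W0 i) unbounded).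
pose m i := (d i).1.1; pose S i := (d i).1.2.
pose a i : K := scal_of_real k (rho i).
pose add i (f : {linear E -> K^o}) : {linear E -> K^o} := f \+ a i \*: (d i).2.
pose sub i (f : {linear E -> K^o}) : {linear E -> K^o} := f \+ - a i \*: (d i).2.
pose F := fix F i : {linear E -> K^o} := if i isn't j.+1 then \0 else
  if rho j `^ t * S j / 4 <= N (m j) (add j (F j)) then add j (F j)
  else sub j (F j).
have norm_ad i y : rnorm (a i *: (d i).2 y) = rho i * rnorm ((d i).2 y).
  by rewrite rnormZ rnorm_scal_of_real// ltW.
have F_step i y : rnorm (F i.+1 y - F i y) <= rho i * rnorm y.
  have [cd _ _ _] := hd i.
  have bnd : rnorm (a i *: (d i).2 y) <= rho i * rnorm y.
    by rewrite norm_ad ler_wpM2l// ltW.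
  rewrite /=; case: ifPn => _ /=; rewrite addrC addKr//.
  by rewrite scaleNr rnormN.
have arith (P q u v : R) : P / 2 <= q -> q <= u + v -> u < P / 4 -> P / 4 <= v.
  lra.
have F_large i : rho i `^ t * S i / 4 <= N (m i) (F i.+1).
  have [cd _ hS _] := hd i.
  rewrite /=; case: ifPn => //; rewrite -ltNge => hadd.
  (* twice the new term is the difference of [add] and [sub]: one is large *)
  have : N (m i) (fun y => a i *: (d i).2 y) <=
      N (m i) (add i (F i)) + N (m i) (sub i (F i)).
    have half : 2 `^ t * N (m i) (fun y => a i *: (d i).2 y) =
        N (m i) (fun y => scal_of_real k 2 *: (a i *: (d i).2 y)).
      apply/esym/N_scale => // y.
      by rewrite rnormZ rnorm_scal_of_real.
    rewrite -(@ler_pM2l _ (2 `^ t)) ?powR_gt0// half; apply: N_triangle => y.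
    apply: le_trans (rnormB_le _ _); rewrite /add /sub/= scaleNr.
    rewrite opprD opprK addrACA subrr add0r.
    rewrite (_ : scal_of_real k 2 = 1 + 1) ?scalerDl ?scale1r//.
    by rewrite (_ : 2 = 1 + 1) // scal_of_realD; case: (k).
  rewrite (@N_scale _ (d i).2 _ (rho i)) ?(ltW (rho0 i))//.
  move=> hsum; apply: (arith _ _ _ _ _ hsum hadd).
  by rewrite -mulrA ler_wpM2l// powR_ge0.
have F0 y : F 0%N y = 0 by [].
clearbody F; have [g hg] := functional_limit F_step.
have tail i : N (m i) (fun y => g y - F i.+1 y) <=
    (2 `^ t)^-1 / 8 * (rho i `^ t * S i).
  have [_ SW _ Smax] := hd i.
  have e0 : 0 < 4 * ratio R ^+ i.+1 by rewrite mulr_gt0// ratio_exp_gt0.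
  have cdiff : contraction (scal_of_real k (4 * ratio R ^+ i.+1)^-1 \*:
      (g \+ -1 \*: F i.+1) : {linear E -> K^o}).
    by apply: rescaled_contraction => // y; rewrite /= scaleN1r.
  have := Smax _ cdiff; rewrite (@N_scale _ (fun y => g y - F i.+1 y) _
     (4 * ratio R ^+ i.+1)^-1) ?invr_ge0 ?(ltW e0)//; last first.
    move=> y; rewrite /= scaleN1r rnormZ rnorm_scal_of_real//.
    by rewrite invr_ge0 ltW.
  rewrite -(powR_inv1 (ltW e0)) -powRrM mulN1r powRN ler_pdivrMl ?powR_gt0// => h.
  apply: (le_trans h); rewrite [leRHS]mulrA ler_wpM2r//.
    exact/ltW/(le_lt_trans (W0 i)).
  have r0 : 0 <= ratio R by rewrite invr_ge0.
  rewrite exprS mulrA powRM ?mulr_ge0 ?exprn_ge0// -[_ ^+ i]/(rho i).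
  rewrite ler_wpM2r ?powR_ge0//.
  have -> : 4 * ratio R = 2^-1 * 8^-1 by rewrite /ratio; lra.
  rewrite powRM ?invr_ge0// -[in X in X * _](powR_inv1 (ler0n R 2)).
  rewrite -powRrM mulN1r powRN.
  rewrite ler_wpM2l ?invr_ge0 ?powR_ge0//.
  by apply: ge1r_powR => //; rewrite invr_gt0 invf_le1//; lra.
have g_large i : i%:R <= N (m i) g.
  have [_ SW _ _] := hd i.
  have tri : N (m i) (F i.+1) <=
      2 `^ t * (N (m i) g + N (m i) (fun y => g y - F i.+1 y)).
    apply: N_triangle => y; apply: le_trans (rnormB_le _ _).
    by rewrite subKr.
  have := le_trans (F_large i) tri; rewrite -ler_pdivrMl ?powR_gt0//.
  have := tail i.
  have : i%:R <= (2 `^ t)^-1 / 8 * (rho i `^ t * S i).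
    have -> : (2 `^ t)^-1 / 8 * (rho i `^ t * S i) = S i / 8 / c i.
      rewrite /c -(powR_inv1 (ltW (rho0 i))) -powRrM mulN1r !powRN.
      by field; rewrite ?gt_eqF// ?powR_gt0.
    by rewrite ler_pdivlMr//; rewrite -/(S i) in SW *; lra.
  lra.
have gc : continuous g.
  apply: (@bounded_continuous _ _ _ 4) => y.
  by have := hg 0%N y; rewrite F0 subr0 expr0 mulr1.
have := wx g gc; rewrite /abs_summable.
have pos j : 0 <= rnorm (g (x j)) `^ t by exact: powR_ge0.
rewrite -ge0_fin_numE; last by apply: nneseries_ge0 => j _ _; rewrite lee_fin.
move/fineK => fin.
set V := fine _ in fin.
pose n := (Num.truncn V).+1.
have := g_large n; apply/negP; rewrite -ltNge.
apply: (@le_lt_trans _ _ V); last exact: truncnS_gt.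
by rewrite -lee_fin fin; exact: partial_le_nneseries.
Qed.

End UniformBound.
End Functionals.

(** * Summing functions and their domination by means *)

Section Summing.
Variables (R : realType) (k : scalar_kind).
Local Notation K := (scalars R k).
Implicit Types (E F : normedModType K).

Lemma bounded_abs_summable (s W : R) E (x : nat -> E) :
  (forall m, \sum_(j < m) rnorm (x j) `^ s <= W) -> abs_summable s x.
Proof.
move=> h; apply: le_lt_trans (ltry W); apply: nneseries_le_partial => // j.
exact: powR_ge0.
Qed.

(** The arguments of the multilinear map are rescaled one after the other. *)
Lemma homogeneous_polynomialZ n (E F : lmodType K) (P : E -> F) :
  homogeneous_polynomial n P -> forall a x, P (a *: x) = a ^+ n *: P x.
Proof.
move=> [A multA PA] a x; rewrite !PA.
pose y m (i : 'I_n) := if (i < m)%N then a *: x else x.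
have yA m : (m <= n)%N -> A (y m) = a ^+ m *: A (fun=> x).
  elim: m => [|m ih] mn; first by rewrite expr0 scale1r.
  pose i0 := Ordinal mn.
  have dfwith_y (u : E) : dfwith (y m) i0 u = fun j => if j == i0 then u else y m j.
    apply/funext => j; case: dfwithP => [|j' ne]; first by rewrite eqxx.
    by rewrite eq_sym (negbTE ne).
  have -> : y m.+1 = dfwith (y m) i0 (a *: x).
    rewrite dfwith_y; apply/funext => j.
    by rewrite /y ltnS leq_eqVlt -val_eqE/=; case: eqP.
  have := multA (y m) i0 a x 0; rewrite addr0 => ->.
  have -> : A (dfwith (y m) i0 0) = 0.
    have := multA (y m) i0 1 0 0; rewrite scaler0 addr0 scale1r.
    by move/esym/eqP; rewrite -subr_eq0 addrK => /eqP.
  rewrite addr0 exprS -scalerA -ih ?(ltnW mn)//; congr (_ *: A _).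
  rewrite dfwith_y; apply/funext => j; case: eqP => // ->.
  by rewrite /y /= ltnn.
have <- : y n = fun=> a *: x by apply/funext => i; rewrite /y ltn_ord.
exact: yA.
Qed.

Section Defs.
Variable E : normedModType K.
Implicit Types (G : E -> R) (xs : seq E) (q C W : R).

(** The [q]-th power of the weak [l_q] norm of [xs] is at most [W]; stated as a
    bound, the supremum over the dual ball need not be formed. *)
Definition weak_sum_le (q : R) xs (W : R) :=
  forall f : {linear E -> K^o}, contraction f ->
    \sum_(x <- xs) rnorm (f x) `^ q <= W.

Definition summing (q : R) G (C : R) := forall xs W, weak_sum_le q xs W ->
  \sum_(x <- xs) G x <= C * W.

Definition pos_homogeneous (q : R) G := forall a x, 0 <= a ->
  G (scal_of_real k a *: x) = a `^ q * G x.

Lemma weak_sum_le_ge0 q xs W : weak_sum_le q xs W -> 0 <= W.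
Proof.
move/(_ _ (@contraction0 R k E)); apply: le_trans.
by apply: sumr_ge0 => x _; exact: powR_ge0.
Qed.

Lemma pos_homogeneous_functional (q : R) (f : {linear E -> K^o}) :
  pos_homogeneous q (fun x => rnorm (f x) `^ q).
Proof.
by move=> a x a0; rewrite linearZ/= rnormZ rnorm_scal_of_real// powRM ?rnorm_ge0.
Qed.

Lemma pos_homogeneous_polynomial (t : R) n (F : normedModType K) (P : E -> F) :
  (0 < n)%N -> homogeneous_polynomial n P ->
  pos_homogeneous t (fun x => rnorm (P x) `^ (t / n%:R)).
Proof.
move=> n0 hP a x a0; rewrite (homogeneous_polynomialZ hP).
have n0' : n%:R != 0 :> R by rewrite pnatr_eq0 -lt0n.
have aX : rnorm ((scal_of_real k a) ^+ n *: P x) = a ^+ n * rnorm (P x).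
  elim: n {n0 n0' hP} => [|m ih]; first by rewrite !expr0 scale1r mul1r.
  by rewrite !exprS -scalerA rnormZ ih rnorm_scal_of_real// mulrA.
rewrite aX powRM ?rnorm_ge0 ?exprn_ge0// -powR_mulrn// -powRrM.
by rewrite mulrCA divff// mulr1.
Qed.

Lemma summing_le q G C C' : C <= C' -> summing q G C -> summing q G C'.
Proof.
move=> CC' hG xs W hW; apply: le_trans (hG xs W hW) _.
by rewrite ler_wpM2r// (weak_sum_le_ge0 hW).
Qed.

Lemma summing_normalized q G C : 0 < q -> pos_homogeneous q G ->
  (forall xs, weak_sum_le q xs 1 -> \sum_(x <- xs) G x <= C) -> summing q G C.
Proof.
move=> q0 homG hG.
have pos xs W : 0 < W -> weak_sum_le q xs W -> \sum_(x <- xs) G x <= C * W.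
  move=> W0 hW; pose a := W^-1 `^ q^-1.
  have aq : a `^ q = W^-1.
    by rewrite /a -powRrM mulVf ?gt_eqF// powRr1// invr_ge0 ltW.
  have a0 : 0 <= a by exact: powR_ge0.
  have := hG [seq scal_of_real k a *: x | x <- xs]; rewrite big_map.
  under eq_bigr do rewrite homG// aq.
  rewrite -mulr_sumr ler_pdivrMl// mulrC; apply.
  move=> f cf; rewrite big_map.
  under eq_bigr do rewrite pos_homogeneous_functional// aq.
  by rewrite -mulr_sumr ler_pdivrMl// mulr1; exact: hW.
move=> xs W hW; have C0 : 0 <= C.
  have := hG [::]; rewrite big_nil; apply => f cf; rewrite big_nil//.
have [W0|W0] := ltP 0 W; first exact: pos.
have -> : W = 0 by apply/eqP; rewrite eq_le W0 (weak_sum_le_ge0 hW).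
(* for [W = 0] let positive values of [W] tend to [0] *)
rewrite mulr0; apply/ler_addgt0Pl => e e0; rewrite addr0.
have C1 : 0 < C + 1 by rewrite ltr_wpDl.
have e1 : 0 < e / (C + 1) by rewrite divr_gt0.
apply: (@le_trans _ _ (C * (e / (C + 1)))).
  apply: pos => // f cf; apply: le_trans (hW f cf) _.
  exact: le_trans W0 (ltW e1).
by rewrite mulrA ler_pdivrMr// mulrC ler_wpM2l ?(ltW e0)// lerDl.
Qed.

(** Sums over finite families control series along weakly summable sequences;
    the uniform bound on the partial sums comes from uniform boundedness on the
    dual ball. *)
Lemma summing_sequence q G C : 1 <= q -> summing q G C ->
  forall x : nat -> E, weakly_summable q x ->
  exists W, forall m, \sum_(j < m) G (x j) <= W.
Proof.
move=> q1 hG x /(weakly_summable_bounded q1)[W hW]; exists (C * W) => m.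
have := hG [seq x j | j <- index_iota 0 m] W.
rewrite big_map big_mkord; apply => f cf; rewrite big_map big_mkord.
exact: hW.
Qed.

(** Finitely many points at a time, a homogeneous summing function is dominated
    by a mean of powers of functionals: by homogeneity the weights of a
    separating functional can be absorbed into the points, and then the summing
    inequality rules it out. *)
Lemma finite_domination q G C : 0 < q -> 0 < C -> (forall x, 0 <= G x) ->
  pos_homogeneous q G -> summing q G C -> forall xs,
  exists2 mu, finite_mean (fun f : {linear E -> K^o} => contraction f) mu &
    forall x, x \in xs -> G x <= 2 * C * mu (fun f => rnorm (f x) `^ q).
Proof.
move=> q0 C0 G0 homG hG xs.
pose mean := @finite_mean R _ (fun f : {linear E -> K^o} => contraction f).
pose moments (mu : ({linear E -> K^o} -> R) -> R) x : R :=
  mu (fun f => rnorm (f x) `^ q).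
pose V (v : E -> R) := exists2 mu, mean mu & v = moments mu.
have dirac (f : {linear E -> K^o}) : contraction f ->
    V (fun x => rnorm (f x) `^ q).
  by move=> cf; exists (fun g => g f) => //; exact: dirac_mean.
have [|c v s c01 [mu hmu ->] [nu hnu ->]|v [mu hmu ->] x xxs|t t0 eta eta0|v] :=
    @convex_domination R E xs V (fun x => G x / C) (\sum_(x <- xs) rnorm x `^ q).
- by eexists; exact/dirac/contraction0.
- by eexists; [exact: mixed_mean c01 hmu hnu|].
- rewrite (mean_ge0 hmu)//=; last by move=> f; exact: powR_ge0.
  apply: (@le_trans _ _ (rnorm x `^ q)).
    rewrite -[leRHS](mean_cst _ hmu); apply: (mean_le hmu) => f cf.
    by rewrite ge0_ler_powR ?nnegrE ?rnorm_ge0// ltW.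
  rewrite (perm_big _ (perm_to_rem xxs))/= big_cons lerDl.
  by apply: sumr_ge0 => y _; exact: powR_ge0.
- apply: contrapT => sep.
  set Sa := \sum_(x <- xs) t x * (G x / C) in sep.
  pose a x := t x `^ q^-1.
  have a0 x : 0 <= a x by exact: powR_ge0.
  have aq x : a x `^ q = t x.
    by rewrite /a -powRrM mulVf ?gt_eqF// powRr1.
  have : Sa <= Sa - eta.
    have := hG [seq scal_of_real k (a x) *: x | x <- xs] (Sa - eta).
    rewrite big_map; under eq_bigr do rewrite homG// aq.
    rewrite mulrC -ler_pdivrMr// mulr_suml.
    under eq_bigr do rewrite -mulrA.
    apply => f cf; rewrite big_map.
    under eq_bigr do rewrite pos_homogeneous_functional// aq.
    rewrite lerBrDr leNgt; apply/negP => h; apply: sep.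
    by exists (fun x => rnorm (f x) `^ q); [exact: dirac|exact: ltW].
  by apply/negP; rewrite -ltNge ltrBlDr ltrDl.
- move=> [mu hmu ->] h; exists mu => // x xxs.
  by have := h x xxs; rewrite ler_pdivrMr// mulrAC.
Qed.

End Defs.

Definition half_exp (i : nat) : R := 2^-1 ^+ i.

Lemma half_exp_gt0 i : 0 < half_exp i.
Proof. by rewrite exprn_gt0// invr_gt0. Qed.

Lemma sum_half_exp (m : nat) : \sum_(i < m) half_exp i <= 2.
Proof.
have : \sum_(i < m) half_exp i = 2 - 2 * half_exp m.
  elim: m => [|m ih]; first by rewrite big_ord0 /half_exp expr0; lra.
  by rewrite big_ord_recr/= ih /half_exp exprSr; lra.
by have := half_exp_gt0 m; lra.
Qed.

Lemma half_expK (i : nat) : half_exp i * 4 ^+ i = 2 ^+ i.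
Proof. by rewrite /half_exp -exprMn; congr (_ ^+ _); lra. Qed.

Lemma exp2_unbounded (V : R) : exists i : nat, V < 2 ^+ i.
Proof.
exists (Num.truncn V).+1; apply: lt_trans (truncnS_gt V) _.
by rewrite -natrX ltr_nat ltn_expl.
Qed.

(** If no constant were valid for all finite families, one could take families
    of weak norm at most 1 on which the sums exceed [4 ^+ i], scale their weak
    sums to [2 ^- i], and concatenate them into a weakly summable sequence along
    which the sums still exceed every [2 ^+ i]. *)
Lemma Pas_summing (t : R) n (E F : normedModType K) (P : E -> F) :
  0 < t -> (0 < n)%N -> Pas (t / n%:R) t n E F P ->
  exists2 C, 0 < C & summing t (fun x => rnorm (P x) `^ (t / n%:R)) C.
Proof.
move=> t0 n0 [homP _ sumP]; set G := fun x => rnorm (P x) `^ (t / n%:R).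
have homG : pos_homogeneous t G by exact: pos_homogeneous_polynomial.
have G_ge0 x : 0 <= G x by exact: powR_ge0.
have n0' : n%:R != 0 :> R by rewrite pnatr_eq0 -lt0n.
have G0 : G 0 = 0.
  by have := homG 0 0 (lexx _); rewrite scaler0 powR0 ?gt_eqF// mul0r.
suff [C hC] : exists C, forall xs, weak_sum_le t xs 1 -> \sum_(x <- xs) G x <= C.
  exists (Num.max C 1); first by rewrite lt_max ltr01 orbT.
  by apply: summing_normalized => // xs /hC; rewrite le_max => ->.
apply: contrapT => unbounded.
have /choice[xs hxs] : forall i : nat, exists xs,
    weak_sum_le t xs 1 /\ 4 ^+ i < \sum_(x <- xs) G x.
  move=> i; apply: contrapT => h; apply: unbounded; exists (4 ^+ i) => xs wxs.
  by rewrite leNgt; apply/negP => lt4; apply: h; exists xs.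
have [e he] := nneseries_pairing R.
pose a i : R := half_exp i `^ t^-1.
have a0 i : 0 <= a i by exact: powR_ge0.
have at_ i : a i `^ t = half_exp i.
  by rewrite /a -powRrM mulVf ?gt_eqF// powRr1// ltW// half_exp_gt0.
pose y z : E := scal_of_real k (a z.1) *: nth 0 (xs z.1) z.2.
have total (H : E -> R) : (forall x, 0 <= H x) -> H 0 = 0 -> pos_homogeneous t H ->
    (\sum_(l <oo) (H (y (e l)))%:E =
     \sum_(i <oo) (half_exp i * \sum_(x <- xs i) H x)%:E)%E.
  move=> H_ge0 H0 homH; rewrite (he (fun z => (H (y z))%:E)).
    apply: eq_eseriesr => i _.
    under eq_eseriesr do rewrite /y/= homH// at_ EFinM.
    rewrite nneseriesZl => [|j _]; last by rewrite lee_fin.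
    by rewrite nneseries_nth.
  by move=> z; rewrite lee_fin.
have term_ge0 (H : E -> R) : (forall x, 0 <= H x) -> forall i,
    0 <= half_exp i * \sum_(x <- xs i) H x.
  move=> H_ge0 i; apply: mulr_ge0; first exact/ltW/half_exp_gt0.
  by apply: sumr_ge0 => x _.
have wy : weakly_summable t (fun l => y (e l)).
  move=> f /continuous_bounded[c c0 fc]; rewrite /abs_summable.
  rewrite (total (fun x => rnorm (f x) `^ t)).
  - apply: (@le_lt_trans _ _ (c `^ t * 2)%:E); last exact: ltry.
    apply: nneseries_le_partial => [i|m].
      by apply: (term_ge0 (fun x => rnorm (f x) `^ t)) => x; exact: powR_ge0.
    apply: (@le_trans _ _ (\sum_(i < m) half_exp i * c `^ t)).
      apply: ler_sum => i _; rewrite ler_wpM2l ?(ltW (half_exp_gt0 _))//.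
      have [wxs _] := hxs i; have := wxs _ (rescaled_contraction c0 fc).
      under eq_bigr do rewrite /= rnormZ rnorm_scal_of_real ?invr_ge0 ?(ltW c0)//
        powRM ?rnorm_ge0 ?invr_ge0 ?(ltW c0)//.
      rewrite -mulr_sumr -(powR_inv1 (ltW c0)) -powRrM mulN1r powRN.
      by rewrite ler_pdivrMl ?powR_gt0// mulr1.
    by rewrite -mulr_suml mulrC ler_wpM2l ?powR_ge0// sum_half_exp.
  - by move=> x; exact: powR_ge0.
  - by rewrite linear0 (rnorm0 K^o) powR0// gt_eqF.
  - exact: pos_homogeneous_functional.
have := sumP _ wy; rewrite /abs_summable.
rewrite -[X in (X < _)%E]/(\sum_(l <oo) (G (y (e l)))%:E)%E.
rewrite total// -ge0_fin_numE; last first.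
  by apply: nneseries_ge0 => i _ _; rewrite lee_fin term_ge0.
move/fineK; set V := fine _ => VE.
have [i Vi] := exp2_unbounded V.
move: Vi; apply/negP; rewrite -leNgt -lee_fin VE.
apply: le_trans (term_le_nneseries i _) => [|j]; last first.
  by rewrite lee_fin term_ge0.
rewrite lee_fin -half_expK ler_wpM2l ?(ltW (half_exp_gt0 _))//.
by have [_ /ltW] := hxs i.
Qed.

End Summing.

(** * From a polynomial to its linear factor *)

Section Transfer.
Variables (R : realType) (k : scalar_kind).
Local Notation K := (scalars R k).

Section FunctionalPower.
Variables (E F : normedModType K) (phi : {linear E -> K^o}) (v : {linear E -> F}).
Implicit Types (n : nat) (p r : R).

Lemma functional_power_polynomial n :
  homogeneous_polynomial n.+1 (fun x => (phi x : K) ^+ n *: v x).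
Proof.
exists (fun y : 'I_n.+1 -> E =>
  (\prod_(i | i != ord_max) (phi (y i) : K)) *: v (y ord_max)); last first.
  move=> x; rewrite prodr_const; congr (_ ^+ _ *: _).
  by rewrite cardC1 card_ord.
move=> y i c x z /=; have [->|ne] := eqVneq i ord_max.
  rewrite !dfwithin linearP scalerDr !scalerA mulrC; congr (_ *: _ + _ *: _);
  [congr (_ * _)|]; by apply: eq_bigr => j jmax; rewrite !dfwithout// eq_sym.
have split u : \prod_(j < n.+1 | j != ord_max) (phi (dfwith y i u j) : K) =
    (phi u : K) * \prod_(j < n.+1 | (j != ord_max) && (j != i)) (phi (y j) : K).
  rewrite (bigD1 i)//= dfwithin; congr (_ * _).
  by apply: eq_bigr => j /andP[_ ji]; rewrite dfwithout// eq_sym.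
by rewrite !dfwithout// !split linearP/= mulrDl scalerDl scalerA mulrA.
Qed.

Lemma rnorm_functional_power n x :
  rnorm ((phi x : K) ^+ n *: v x) = rnorm (phi x) ^+ n * rnorm (v x).
Proof.
elim: n => [|n ih]; first by rewrite !expr0 scale1r mul1r.
by rewrite !exprS -scalerA rnormZ ih mulrA.
Qed.

(** A product of [n.+1] nonnegative factors is at most the [n.+1]-th power of the
    largest, whose [p]-th power is one of two summable terms. *)
Lemma functional_power_Pas n p C : 1 <= p -> contraction phi -> continuous v ->
  summing p (fun x => rnorm (v x) `^ p) C ->
  Pas (p / n.+1%:R) p n.+1 E F (fun x => (phi x : K) ^+ n *: v x).
Proof.
move=> p1 cphi cv sv; have p0 : 0 <= p by apply: le_trans p1.
split; first exact: functional_power_polynomial.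
  have cphi' : continuous phi by exact: contraction_continuous.
  move=> x; suff cvg_power m : (phi y : K) ^+ m *: v y @[y --> x] -->
      (phi x : K) ^+ m *: v x by exact: cvg_power.
  elim: m => [|m ih].
    rewrite expr0 scale1r (_ : (fun y => _) = v); first exact: cv.
    by apply/funext => y; rewrite expr0 scale1r.
  rewrite exprS -scalerA (_ : (fun y => _) =
      (fun y => (phi y : K) *: ((phi y : K) ^+ m *: v y))); last first.
    by apply/funext => y; rewrite exprS scalerA.
  exact: cvgZ (cphi' x) ih.
have s1 : summing p (fun x =>
    rnorm ((phi x : K) ^+ n *: v x) `^ (p / n.+1%:R)) (1 + C).
  move=> xs W wxs; rewrite mulrDl mul1r.
  apply: le_trans (lerD (wxs _ cphi) (sv xs W wxs)).
  rewrite -big_split/=; apply: ler_sum => x _.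
  rewrite rnorm_functional_power.
  set s := rnorm (phi x); set t := rnorm (v x).
  have s0 : 0 <= s by exact: rnorm_ge0.
  have t0 : 0 <= t by exact: rnorm_ge0.
  have pw (q : R) : 0 <= q -> (q ^+ n.+1) `^ (p / n.+1%:R) = q `^ p.
    by move=> q0; rewrite -powR_mulrn// -powRrM mulrCA divff ?mulr1// pnatr_eq0.
  have pn0 : 0 <= p / n.+1%:R by rewrite divr_ge0.
  have [st|/ltW ts] := leP s t.
    apply: (@le_trans _ _ (t `^ p)); last by rewrite lerDr powR_ge0.
    rewrite -[leRHS]pw// ge0_ler_powR ?nnegrE ?mulr_ge0 ?exprn_ge0//.
    by rewrite exprSr ler_wpM2r// lerXn2r.
  apply: (@le_trans _ _ (s `^ p)); last by rewrite lerDl powR_ge0.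
  rewrite -[leRHS]pw// ge0_ler_powR ?nnegrE ?mulr_ge0 ?exprn_ge0//.
  by rewrite exprSr ler_wpM2l// exprn_ge0.
move=> x wx; have [W hW] := summing_sequence p1 s1 wx.
exact: bounded_abs_summable hW.
Qed.

Variable a : E.
Hypothesis phi_a : phi a = 1.

Definition kernel_proj (x : E) : E := x - phi x *: a.

Fact kernel_proj_linear : linear kernel_proj.
Proof.
move=> c x y; rewrite /kernel_proj linearP/= scalerDl scalerBr -scalerA.
by rewrite opprD addrACA.
Qed.
HB.instance Definition _ := GRing.isLinear.Build K E E _ kernel_proj
  kernel_proj_linear.

Lemma phi_kernel_proj x : phi (kernel_proj x) = 0.
Proof. by rewrite linearB linearZ/= phi_a /GRing.scale/= mulr1 subrr. Qed.

Lemma kernel_proj_a : kernel_proj a = 0.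
Proof. by rewrite /kernel_proj phi_a scale1r subrr. Qed.

Hypothesis phi_contraction : contraction phi.

Lemma rnorm_kernel_proj x : rnorm (kernel_proj x) <= (1 + rnorm a) * rnorm x.
Proof.
apply: (le_trans (rnormB_le _ _)); rewrite rnormZ mulrDl mul1r lerD2l mulrC.
by rewrite ler_wpM2l ?rnorm_ge0.
Qed.

Lemma weak_sum_kernel_proj q xs W : 0 < q -> weak_sum_le q xs W ->
  forall f : {linear E -> K^o}, contraction f ->
  \sum_(x <- xs) rnorm (f (kernel_proj x)) `^ q <= (1 + rnorm a) `^ q * W.
Proof.
move=> q0 wxs f cf; have c0 : 0 < 1 + rnorm a.
  by rewrite (lt_le_trans ltr01)// lerDl rnorm_ge0.
have bnd x : rnorm ((f \o kernel_proj) x) <= (1 + rnorm a) * rnorm x.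
  exact: le_trans (cf _) (rnorm_kernel_proj x).
have := wxs _ (rescaled_contraction c0 bnd).
under eq_bigr do rewrite /= rnormZ rnorm_scal_of_real ?invr_ge0 ?(ltW c0)//
  powRM ?rnorm_ge0 ?invr_ge0 ?(ltW c0)//.
rewrite -mulr_sumr -(powR_inv1 (ltW c0)) -powRrM mulN1r powRN.
by rewrite ler_pdivrMl ?powR_gt0.
Qed.

Hypothesis v_a : v a = 0.

(** Test the polynomial on the points [s x *: a + kernel_proj x], where it takes
    the value [s x ^+ n *: v x].  If [s x] is proportional to the norm of [v x],
    normalized so that the [s x `^ r] sum to [1], the estimate bounds the root of
    order [n.+1] of the sum [T] of the [rnorm (v x) `^ r]. *)
Lemma linear_factor_summing n r C : 0 < r ->
  summing r (fun x => rnorm ((phi x : K) ^+ n *: v x) `^ (r / n.+1%:R)) C ->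
  summing r (fun x => rnorm (v x) `^ r)
    ((C * (2 `^ r * (rnorm a `^ r + (1 + rnorm a) `^ r))) ^+ n.+1).
Proof.
move=> r0 sP; set C1 := 2 `^ r * _.
have r0' : 0 <= r by exact: ltW.
apply: summing_normalized => //.
  by move=> c x c0; rewrite linearZ/= rnormZ rnorm_scal_of_real// powRM ?rnorm_ge0.
move=> xs wxs; set T := \sum_(x <- xs) _.
have T_ge0 : 0 <= T by apply: sumr_ge0 => x _; exact: powR_ge0.
have C0 : 0 <= C.
  have := sP [::] 1; rewrite big_nil mulr1; apply => f cf.
  by rewrite big_nil.
have C1_ge0 : 0 <= C1.
  by rewrite mulr_ge0 ?addr_ge0 ?powR_ge0.
have C_T : T `^ n.+1%:R^-1 <= C * C1.
  have [->|T0] := eqVneq T 0.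
    by rewrite powR0 ?invr_eq0 ?pnatr_eq0// mulr_ge0.
  have T_gt0 : 0 < T by rewrite lt_neqAle eq_sym T0.
  pose s x := rnorm (v x) * T `^ (- r^-1).
  have s_ge0 x : 0 <= s x by rewrite mulr_ge0 ?rnorm_ge0 ?powR_ge0.
  have s_sum : \sum_(x <- xs) s x `^ r = 1.
    under eq_bigr do rewrite powRM ?rnorm_ge0 ?powR_ge0// -powRrM mulNr.
    by rewrite -mulr_suml mulVf ?gt_eqF// powRN powRr1// divff.
  pose y x := scal_of_real k (s x) *: a + kernel_proj x.
  have phi_y x : phi (y x) = scal_of_real k (s x).
    by rewrite linearD linearZ/= phi_a phi_kernel_proj addr0 /GRing.scale/= mulr1.
  have v_y x : v (y x) = v x.
    rewrite linearD linearZ/= v_a scaler0 add0r.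
    by rewrite linearB linearZ/= v_a scaler0 subr0.
  have wy : weak_sum_le r [seq y x | x <- xs] C1.
    move=> f cf; rewrite big_map.
    apply: (@le_trans _ _ (\sum_(x <- xs) 2 `^ r * (s x `^ r * rnorm a `^ r +
        rnorm (f (kernel_proj x)) `^ r))).
      apply: ler_sum => x _; rewrite -powRM ?rnorm_ge0//.
      have sa0 : 0 <= s x * rnorm a := mulr_ge0 (s_ge0 x) (rnorm_ge0 a).
      apply: le_trans (powR_addl_le _ _ _); rewrite ?rnorm_ge0//.
      rewrite ge0_ler_powR ?nnegrE ?rnorm_ge0//.
        by rewrite addr_ge0// rnorm_ge0.
      rewrite /y linearD linearZ/=; apply: (le_trans (rnormD _ _)); rewrite lerD2r.
      by rewrite rnormZ rnorm_scal_of_real// ler_wpM2l.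
    rewrite -mulr_sumr ler_wpM2l ?powR_ge0// big_split/= -mulr_suml s_sum mul1r.
    rewrite lerD2l -[leRHS]mulr1; exact: weak_sum_kernel_proj.
  have := sP _ _ wy; rewrite big_map; congr (_ <= _).
  have powT : T `^ n.+1%:R^-1 = T * T `^ (- (n%:R / n.+1%:R)).
    rewrite -[T in T * _](powRr1 T_ge0) -powRD ?T0 ?implybT//; congr (_ `^ _).
    by rewrite -(natr1 n); field; rewrite natr1 pnatr_eq0.
  rewrite powT mulr_suml; apply: eq_bigr => x _.
  rewrite rnorm_functional_power phi_y v_y rnorm_scal_of_real//.
  have -> : s x ^+ n * rnorm (v x) = rnorm (v x) ^+ n.+1 * (T `^ (- r^-1)) ^+ n.
    by rewrite /s exprMn exprSr mulrAC.
  rewrite powRM ?exprn_ge0 ?rnorm_ge0 ?powR_ge0//.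
  congr (_ * _).
    by rewrite -powR_mulrn ?rnorm_ge0// -powRrM mulrCA divff ?mulr1// pnatr_eq0.
  rewrite -powR_mulrn ?powR_ge0// -!powRrM; congr (_ `^ _).
  by field; rewrite nat1r pnatr_eq0 (gt_eqF r0).
have -> : T = (T `^ n.+1%:R^-1) ^+ n.+1.
  by rewrite -powR_mulrn ?powR_ge0// -powRrM mulVf ?pnatr_eq0// powRr1.
by rewrite lerXn2r// nnegrE ?powR_ge0// mulr_ge0.
Qed.

End FunctionalPower.
End Transfer.

(** * Moments of means and operators into [lp] *)

Section Moments.
Variables (R : realType) (k : scalar_kind) (E : normedModType (scalars R k)).
Local Notation K := (scalars R k).
Local Notation D := {linear E -> K^o}.
Implicit Types (mu : (D -> R) -> R) (p q r : R).

Definition dual_mean mu := finite_mean (fun f : D => contraction f) mu.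

Definition moment mu q (x : E) : R := mu (fun f => rnorm (f x) `^ q).

Lemma moment_ge0 mu q x : dual_mean mu -> 0 <= moment mu q x.
Proof. by move=> hmu; apply: (mean_ge0 hmu) => f; exact: powR_ge0. Qed.

Lemma moment_le mu q x : 0 <= q -> dual_mean mu -> moment mu q x <= rnorm x `^ q.
Proof.
move=> q0 hmu; rewrite -[leRHS](mean_cst _ hmu); apply: (mean_le hmu) => f cf.
by rewrite ge0_ler_powR ?nnegrE ?rnorm_ge0.
Qed.

Lemma pos_homogeneous_moment mu q : dual_mean mu -> pos_homogeneous q (moment mu q).
Proof.
move=> hmu a x a0; rewrite /moment -(meanZ _ _ hmu); congr (mu _).
by apply/funext => f; rewrite pos_homogeneous_functional.
Qed.

Lemma pos_homogeneous_powR mu q s : dual_mean mu ->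
  pos_homogeneous (q * s) (fun x => moment mu q x `^ s).
Proof.
move=> hmu a x a0; rewrite pos_homogeneous_moment// powRM ?powR_ge0 ?moment_ge0//.
by rewrite powRrM.
Qed.

Lemma moment_sum mu q (xs : seq E) (W : R) (h : E -> E) : dual_mean mu ->
  (forall f : D, contraction f -> \sum_(x <- xs) rnorm (f (h x)) `^ q <= W) ->
  \sum_(x <- xs) moment mu q (h x) <= W.
Proof.
move=> hmu hW.
rewrite -(@mean_sum _ D _ mu _ xs (fun x f => rnorm (f (h x)) `^ q) hmu).
by rewrite -[leRHS](mean_cst _ hmu); exact: (mean_le hmu).
Qed.

Section Operator.
Variables (p : R) (p1 : 1 <= p) (mu : nat -> (D -> R) -> R).
Hypothesis mean_mu : forall i, dual_mean (mu i).

Let term_ge0 x i : 0 <= half_exp R i * moment (mu i) p x.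
Proof. by rewrite mulr_ge0 ?moment_ge0// ltW// half_exp_gt0. Qed.

(** Countably many finitely supported means can be stored in one operator into
    [lp]: its coordinates are the functionals in their supports, rescaled by the
    [p]-th roots of their weights. *)
Lemma lp_operator_of_means : exists u : {linear E -> lp k p1}, forall x,
  ((rnorm (u x) `^ p)%:E =
   \sum_(i <oo) (half_exp R i * moment (mu i) p x)%:E)%E.
Proof.
have p0 : 0 < p by apply: lt_le_trans p1.
have /choice[w /choice[g hg]] := fun i => mean_series (mean_mu i).
have [e he] := nneseries_pairing R.
pose c z : R := (half_exp R z.1 * w z.1 z.2) `^ p^-1.
pose coord x : nat -> K := fun l => scal_of_real k (c (e l)) *: g (e l).1 (e l).2 x.
have c0 z : 0 <= c z by exact: powR_ge0.
have cp z : c z `^ p = half_exp R z.1 * w z.1 z.2.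
  rewrite /c -powRrM mulVf ?gt_eqF// powRr1//.
  by have [w0 _ _] := hg z.1; rewrite mulr_ge0// ltW// half_exp_gt0.
have sum_coord x : (\sum_(l <oo) (rnorm (coord x l : K^o) `^ p)%:E =
    \sum_(i <oo) (half_exp R i * moment (mu i) p x)%:E)%E.
  rewrite (he (fun z => (rnorm (scal_of_real k (c z) *: g z.1 z.2 x) `^ p)%:E));
    last by move=> z; rewrite lee_fin powR_ge0.
  apply: eq_eseriesr => i _.
  under eq_eseriesr do rewrite rnormZ rnorm_scal_of_real// powRM ?rnorm_ge0//
    cp/= -mulrA EFinM.
  have [w0 _ hmu] := hg i.
  rewrite nneseriesZl => [|j _].
    by rewrite (hmu (fun f => rnorm (f x) `^ p))// => f; exact: powR_ge0.
  by rewrite lee_fin mulr_ge0 ?powR_ge0.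
have bounded x : (\sum_(i <oo) (half_exp R i * moment (mu i) p x)%:E < +oo)%E.
  apply: (@le_lt_trans _ _ (2 * rnorm x `^ p)%:E); last exact: ltry.
  apply: nneseries_le_partial => // m.
  apply: (@le_trans _ _ (\sum_(i < m) half_exp R i * rnorm x `^ p)).
    apply: ler_sum => i _; rewrite ler_wpM2l ?moment_le// ltW//.
    exact: half_exp_gt0.
  by rewrite -mulr_suml ler_wpM2r ?powR_ge0// sum_half_exp.
have coord_lp x : coord x \in lp_seq p1 by rewrite inE/= /abs_summable sum_coord.
pose u x : lp k p1 := Lp (coord_lp x).
have ulin : linear u.
  move=> b x y; apply/val_inj/funext => l /=.
  rewrite /coord linearP scalerDr !scalerA mulrC -scalerA.
  by [].
pose uL := GRing.isLinear.Build K E (lp k p1) _ u ulin.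
exists (HB.pack_for {linear E -> lp k p1} u uL) => x /=.
rewrite {1}/rnorm /Num.norm/= /lp_norm scal_of_realK sum_coord -powRrM.
rewrite mulVf ?gt_eqF// powRr1; last first.
  by apply/fine_ge0/nneseries_ge0 => i _ _; rewrite lee_fin.
rewrite fineK// ge0_fin_numE//.
by apply: nneseries_ge0 => i _ _; rewrite lee_fin.
Qed.

Variable u : {linear E -> lp k p1}.
Hypothesis norm_u : forall x, ((rnorm (u x) `^ p)%:E =
   \sum_(i <oo) (half_exp R i * moment (mu i) p x)%:E)%E.

Lemma moment_le_operator i x : half_exp R i * moment (mu i) p x <= rnorm (u x) `^ p.
Proof.
rewrite -lee_fin norm_u.
apply: (@term_le_nneseries R
  (fun j => (half_exp R j * moment (mu j) p x)%:E) i) => j.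
by rewrite lee_fin.
Qed.

(** Summing over [xs] first and integrating afterwards only involves sums at a
    single functional. *)
Lemma operator_sum_le (xs : seq E) (W : R) (h : E -> E) :
  (forall f : D, contraction f -> \sum_(x <- xs) rnorm (f (h x)) `^ p <= W) ->
  \sum_(x <- xs) rnorm (u (h x)) `^ p <= 2 * W.
Proof.
move=> hW; rewrite -lee_fin -sumEFin.
under eq_bigr do rewrite norm_u.
rewrite -nneseries_sum => [|x i _]; last by rewrite lee_fin.
under eq_eseriesr do rewrite sumEFin.
apply: nneseries_le_partial => [i|m]; first by apply: sumr_ge0.
apply: (@le_trans _ _ (\sum_(i < m) half_exp R i * W)).
  apply: ler_sum => i _; rewrite -mulr_sumr ler_wpM2l//.
    exact/ltW/half_exp_gt0.
  exact: moment_sum.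
rewrite -mulr_suml ler_wpM2r ?sum_half_exp//.
apply: le_trans (hW _ (@contraction0 R k E)).
by apply: sumr_ge0 => x _; exact: powR_ge0.
Qed.

End Operator.

End Moments.

(** * Extrapolation *)

Section Extrapolation.
Variables (R : realType) (k : scalar_kind) (E : normedModType (scalars R k)).
Local Notation K := (scalars R k).
Local Notation D := {linear E -> K^o}.
Implicit Types (mu : (D -> R) -> R) (p q r : R).

Lemma summing_continuous (F : normedModType K) (v : {linear E -> F}) p C :
  0 < p -> 0 <= C -> summing p (fun x => rnorm (v x) `^ p) C -> continuous v.
Proof.
move=> p0 C0 sv; apply: (@bounded_continuous _ _ _ _ _ (C `^ p^-1)) => x.
have root (y : R) : 0 <= y -> y = (y `^ p) `^ p^-1.
  by move=> y0; rewrite -powRrM divff ?gt_eqF// powRr1.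
rewrite (root (rnorm (v x))) ?rnorm_ge0// [in leRHS](root (rnorm x)) ?rnorm_ge0//.
rewrite -powRM ?powR_ge0//.
rewrite ge0_ler_powR ?nnegrE ?mulr_ge0 ?powR_ge0 ?invr_ge0 ?(ltW p0)//.
have := sv [:: x] (rnorm x `^ p); rewrite big_seq1; apply => f cf.
by rewrite big_seq1 ge0_ler_powR ?nnegrE ?rnorm_ge0 ?(ltW p0).
Qed.

Section Coincidence.
Variables (n : nat) (p r : R) (p1 : 1 <= p).
Hypotheses (r_gt0 : 0 < r) (r_lt_p : r < p).
Hypothesis coincidence :
  Pas (p / n.+1%:R) p n.+1 E (lp k p1) `<=` Pas (r / n.+1%:R) r n.+1 E (lp k p1).

Let p_gt0 : 0 < p. Proof. exact: lt_le_trans p1. Qed.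

Let rp_ge0 : 0 <= r / p. Proof. by rewrite divr_ge0// ltW. Qed.

(** Means violating the inequality with the constants [4 ^+ i] could be stored,
    with the weights [2 ^- i], in a single operator into [lp].  Multiplied by [n]
    copies of [phi] it becomes a polynomial to which the coincidence applies, so
    that the operator is itself [r]-summing, with one constant for all [i]. *)
Lemma projected_moments_summing (phi : D) (a : E) :
  contraction phi -> phi a = 1 ->
  exists C, forall mu, dual_mean mu ->
    summing r (fun x => moment mu p (kernel_proj phi a x) `^ (r / p)) C.
Proof.
move=> cphi phi_a; apply: contrapT => unbounded.
have /choice[mu hmu] : forall i : nat, exists mu, dual_mean mu /\
    ~ summing r (fun x => moment mu p (kernel_proj phi a x) `^ (r / p)) (4 ^+ i).
  move=> i; apply: contrapT => h; apply: unbounded; exists (4 ^+ i) => mu hmu.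
  by apply: contrapT => h'; apply: h; exists mu.
have mean_mu i : dual_mean (mu i) by have [] := hmu i.
have [u hu] := lp_operator_of_means p1 mean_mu.
pose v : {linear E -> lp k p1} := u \o kernel_proj phi a.
have v_a : v a = 0 by rewrite /v/= kernel_proj_a// linear0.
have sv : summing p (fun x => rnorm (v x) `^ p) (2 * (1 + rnorm a) `^ p).
  move=> xs W wxs; rewrite -mulrA.
  apply: (operator_sum_le mean_mu hu (h := kernel_proj phi a)).
  exact: weak_sum_kernel_proj.
have cv : continuous v.
  by apply: summing_continuous sv; rewrite ?mulr_ge0 ?powR_ge0.
have /coincidence P_Pas := functional_power_Pas n p1 cphi cv sv.
have [C C0 sP] := Pas_summing r_gt0 (ltn0Sn n) P_Pas.
have := linear_factor_summing phi_a cphi v_a r_gt0 sP; set C' := _ ^+ n.+1 => sv'.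
have [i Ci] := exp2_unbounded C'.
have [_] := hmu i; apply => xs W wxs.
have W0 := weak_sum_le_ge0 wxs.
apply: (@le_trans _ _ (2 ^+ i * \sum_(x <- xs) rnorm (v x) `^ r)).
  rewrite mulr_sumr; apply: ler_sum => x _.
  have dom : moment (mu i) p (kernel_proj phi a x) <= 2 ^+ i * rnorm (v x) `^ p.
    have := moment_le_operator mean_mu hu i (kernel_proj phi a x).
    have half2 : half_exp R i = (2 ^+ i)^-1 by rewrite /half_exp exprVn.
    by rewrite half2 ler_pdivrMl ?exprn_gt0.
  apply: (@le_trans _ _ ((2 ^+ i * rnorm (v x) `^ p) `^ (r / p))).
    by rewrite ge0_ler_powR ?rp_ge0 ?nnegrE ?mulr_ge0 ?exprn_ge0 ?powR_ge0 ?moment_ge0.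
  rewrite powRM ?exprn_ge0 ?powR_ge0// -powRrM mulrCA divff ?gt_eqF// mulr1.
  rewrite ler_wpM2r ?powR_ge0// -[leRHS]powRr1 ?exprn_ge0//.
  by rewrite ler_powR ?exprn_ege1// ?ler1n// ler_pdivrMr// mul1r ltW.
have -> : 4 ^+ i = 2 ^+ i * 2 ^+ i :> R by rewrite -exprMn; congr (_ ^+ _); lra.
rewrite -mulrA ler_wpM2l ?exprn_ge0//; apply: (le_trans (sv' xs W wxs)).
by rewrite ler_wpM2r// ltW.
Qed.

(** [x] differs from its projection by a multiple of [a] with coefficient
    [phi x], whose [r]-th powers are summable by assumption. *)
Lemma moments_summing : exists2 C, 0 < C & forall mu, dual_mean mu ->
  summing r (fun x => moment mu p x `^ (r / p)) C.
Proof.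
have [[phi [a [cphi phi_a]]]|trivial] := pselect (exists (phi : D) a,
    contraction phi /\ phi a = 1); last first.
  (* all continuous functionals vanish, and so do all moments *)
  exists 1 => // mu hmu xs W wxs; rewrite mul1r.
  apply: (@le_trans _ _ 0); last exact: weak_sum_le_ge0 wxs.
  rewrite big1// => x _; suff -> : moment mu p x = 0.
    by rewrite powR0// gt_eqF// divr_gt0.
  apply/eqP; rewrite eq_le moment_ge0// andbT -[leRHS](mean_cst _ hmu).
  apply: (mean_le hmu) => f cf; suff -> : f x = 0.
    by rewrite (rnorm0 K^o) powR0// gt_eqF.
  apply: contrapT => /eqP fx; apply: trivial.
  exists f, ((f x)^-1 *: x); split => //.
  by rewrite linearZ/= /GRing.scale/= mulVf.
have [C hC] := projected_moments_summing cphi phi_a.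
pose A : R := 2 `^ r * 2 `^ (r / p).
pose C1 := A * (C + rnorm a `^ r).
exists (Num.max 1 C1) => [|mu hmu]; first by rewrite lt_max ltr01.
apply: (@summing_le _ _ _ _ _ C1); first by rewrite le_max lexx orbT.
move=> xs W wxs; rewrite -mulrA mulrDl.
apply: (@le_trans _ _ (A * (\sum_(x <- xs)
    moment mu p (kernel_proj phi a x) `^ (r / p) +
    rnorm a `^ r * \sum_(x <- xs) rnorm (phi x) `^ r))).
  rewrite [X in _ * (_ + X)]mulr_sumr -big_split/= mulr_sumr.
  apply: ler_sum => x _.
  have m0 := moment_ge0 p (kernel_proj phi a x) hmu.
  have pa0 : 0 <= (rnorm (phi x) * rnorm a) `^ p by exact: powR_ge0.
  have split : moment mu p x <= 2 `^ p *
      (moment mu p (kernel_proj phi a x) + (rnorm (phi x) * rnorm a) `^ p).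
    rewrite -[X in _ * (_ + X)](mean_cst _ hmu) -(meanD _ _ hmu) -(meanZ _ _ hmu).
    apply: (mean_le hmu) => f cf.
    apply: le_trans (powR_addl_le _ _ _); rewrite ?mulr_ge0 ?rnorm_ge0 ?(ltW p_gt0)//.
    rewrite ge0_ler_powR ?nnegrE ?addr_ge0 ?mulr_ge0 ?rnorm_ge0 ?(ltW p_gt0)//.
    have {1}-> : x = kernel_proj phi a x + phi x *: a by rewrite subrK.
    rewrite linearD linearZ; apply: (le_trans (rnormD _ _)); rewrite lerD2l.
    by rewrite rnormZ ler_wpM2l ?rnorm_ge0.
  apply: (@le_trans _ _ ((2 `^ p * (moment mu p (kernel_proj phi a x) +
      (rnorm (phi x) * rnorm a) `^ p)) `^ (r / p))).
    by rewrite ge0_ler_powR ?rp_ge0 ?nnegrE ?mulr_ge0 ?addr_ge0 ?powR_ge0 ?moment_ge0.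
  have prp q : (q `^ p) `^ (r / p) = q `^ r.
    by rewrite -powRrM mulrCA divff ?gt_eqF// mulr1.
  rewrite powRM ?powR_ge0 ?addr_ge0// prp -mulrA ler_wpM2l ?powR_ge0//.
  apply: (le_trans (powR_addl_le _ _ _)) => //.
  by rewrite prp powRM ?rnorm_ge0// [X in _ * (_ + X)]mulrC.
rewrite ler_wpM2l ?mulr_ge0 ?powR_ge0//; apply: lerD; first exact: hC.
by rewrite ler_wpM2l ?powR_ge0//; exact: wxs.
Qed.

End Coincidence.

(** The extrapolation argument.  For a fixed finite family of weak [l_1] norm at
    most 1, let [S] be the supremum over all means of the sums to be bounded; it
    is finite, but a priori depends on the family.  Any mean is dominated by the
    [r]-th moments of another one, which interpolate between orders [1] and [p];
    the sums of the former are at most 1 and those of the latter at most [S].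
    Hence [S <= c * S `^ eta] with [eta < 1], which bounds [S] by a power of
    [c]. *)
Lemma root_moments_summing p r C : 1 < r -> r < p -> 0 < C ->
  (forall mu, dual_mean mu -> summing r (fun x => moment mu p x `^ (r / p)) C) ->
  exists B, forall mu, dual_mean mu ->
    summing 1 (fun x => moment mu p x `^ p^-1) B.
Proof.
move=> r1 rp C0 hC.
have r0 : 0 < r by rewrite (lt_trans ltr01).
have p1 : 1 < p by exact: lt_trans rp.
have p0 : 0 < p by rewrite (lt_trans ltr01).
have p10 : 0 < p - 1 by rewrite subr_gt0.
have nz : [&& r != 0, p != 0 & p - 1 != 0] by rewrite !gt_eqF.
have /and3P[rn pn p1n] := nz.
(* the solution of [theta + eta = 1] and [theta + eta / p = r^-1] *)
pose theta := (p - r) / (r * (p - 1)).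
pose eta := p * (r - 1) / (r * (p - 1)).
have theta0 : 0 < theta by rewrite divr_gt0 ?mulr_gt0 ?subr_gt0.
have eta0 : 0 < eta by rewrite divr_gt0 ?mulr_gt0 ?subr_gt0.
have te : theta + eta = 1 by rewrite /theta /eta; field; rewrite rn p1n.
pose c := (2 * C) `^ r^-1.
have c0 : 0 <= c by exact: powR_ge0.
exists (c `^ theta^-1) => mu0 hmu0.
apply: summing_normalized => //.
  by have := pos_homogeneous_powR p p^-1 hmu0; rewrite divff.
move=> xs wxs.
pose T mu := \sum_(x <- xs) moment mu p x `^ p^-1.
pose A := [set T mu | mu in [set mu | dual_mean mu]].
have supA : has_sup A.
  split; first by exists (T mu0), mu0.
  exists (\sum_(x <- xs) rnorm x) => _ [mu hmu <-].
  apply: ler_sum => x _.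
  rewrite -[leRHS](powRr1 (rnorm_ge0 x)) -[in leRHS](divff pn) powRrM.
  by rewrite ge0_ler_powR ?nnegrE ?powR_ge0 ?invr_ge0 ?moment_ge0 ?moment_le ?(ltW p0).
set S := sup A.
have T_le mu : dual_mean mu -> T mu <= S.
  by move=> hmu; apply: sup_upper_bound => //; exists mu.
have S_ge0 : 0 <= S.
  by apply: le_trans (T_le _ hmu0); apply: sumr_ge0 => x _; exact: powR_ge0.
have step mu : dual_mean mu -> T mu <= c * S `^ eta.
  move=> hmu.
  have hom : pos_homogeneous r (fun x => moment mu p x `^ (r / p)).
    by have := pos_homogeneous_powR p (r / p) hmu; rewrite mulrCA divff ?mulr1.
  have [nu hnu dom] :=
    finite_domination r0 C0 (fun=> powR_ge0 _ _) hom (hC _ hmu) xs.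
  have pointwise x : x \in xs -> moment mu p x `^ p^-1 <=
      c * (moment nu 1 x `^ theta * (moment nu p x `^ p^-1) `^ eta).
    move=> xxs.
    have -> : moment mu p x `^ p^-1 = (moment mu p x `^ (r / p)) `^ r^-1.
      by rewrite -powRrM; congr (_ `^ _); field; rewrite rn pn.
    apply: (@le_trans _ _ ((2 * C * moment nu r x) `^ r^-1)).
      rewrite ge0_ler_powR ?nnegrE ?powR_ge0 ?invr_ge0 ?(ltW r0) ?dom//.
      by rewrite !mulr_ge0 ?moment_ge0// ltW.
    rewrite powRM ?moment_ge0 ?mulr_ge0 ?(ltW C0)// -/c ler_wpM2l//.
    have interp : moment nu r x <= moment nu 1 x `^ ((p - r) / (p - 1)) *
        moment nu p x `^ ((r - 1) / (p - 1)).
      have -> : moment nu 1 x = nu (fun f => rnorm (f x)).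
        by congr nu; apply/funext => f; rewrite powRr1 ?rnorm_ge0.
      exact: (mean_interpolation hnu r1 rp (fun f : D => rnorm_ge0 (f x))).
    apply: (@le_trans _ _ ((moment nu 1 x `^ ((p - r) / (p - 1)) *
        moment nu p x `^ ((r - 1) / (p - 1))) `^ r^-1)).
      by rewrite ge0_ler_powR ?nnegrE ?mulr_ge0 ?powR_ge0 ?invr_ge0 ?moment_ge0 ?(ltW r0).
    rewrite powRM ?powR_ge0// -!powRrM.
    rewrite (_ : _ * r^-1 = theta); last by rewrite /theta; field; rewrite rn p1n.
    rewrite (_ : _ * r^-1 = p^-1 * eta)//.
    by rewrite /eta; field; rewrite rn p1n pn.
  apply: (@le_trans _ _ (\sum_(x <- xs)
      c * (moment nu 1 x `^ theta * (moment nu p x `^ p^-1) `^ eta))).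
    by rewrite /T !big_seq; exact: ler_sum.
  rewrite -mulr_sumr ler_wpM2l//.
  apply: (le_trans (hoelder_sum xs theta0 eta0 te _ _)) => [x|x|].
  - exact: moment_ge0.
  - exact: powR_ge0.
  have m1 : \sum_(x <- xs) moment nu 1 x <= 1.
    exact: (moment_sum (h := id) hnu).
  have m10 : 0 <= \sum_(x <- xs) moment nu 1 x.
    by apply: sumr_ge0 => x _; exact: moment_ge0.
  rewrite -[leRHS]mul1r ler_pM ?powR_ge0//.
    apply: (@le_trans _ _ (1 `^ theta)); last by rewrite powR1.
    by rewrite ge0_ler_powR ?nnegrE ?(ltW theta0).
  rewrite ge0_ler_powR ?nnegrE ?(ltW eta0)// ?T_le//.
  by apply: sumr_ge0 => x _; exact: powR_ge0.
have S_le : S <= c * S `^ eta.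
  by apply: ge_sup => [|_ [mu hmu <-]]; [case: supA|exact: step].
apply: (le_trans (T_le _ hmu0)).
have [->|S0] := eqVneq S 0; first exact: powR_ge0.
have S_gt0 : 0 < S by rewrite lt_neqAle eq_sym S0.
have Stheta : S `^ theta <= c.
  rewrite -(ler_pM2r (powR_gt0 eta S_gt0)) -powRD ?S0 ?implybT// te powRr1//.
rewrite -[leLHS](powRr1 S_ge0) -[in leLHS](divff (lt0r_neq0 theta0)) powRrM.
by rewrite ge0_ler_powR ?nnegrE ?powR_ge0 ?invr_ge0 ?(ltW theta0).
Qed.

End Extrapolation.

(** * Inclusions between spaces of summing polynomials *)

Section Inclusions.
Variables (R : realType) (k : scalar_kind) (E F : normedModType (scalars R k)).
Variables (n : nat) (p : R).
Hypothesis p_ge1 : 1 <= p.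

Let p_gt0 : 0 < p. Proof. exact: lt_le_trans p_ge1. Qed.

(** A mean dominating [P] on a finite family reduces the sums of the norms of [P]
    to the power [n.+1^-1] to sums of roots of [p]-th moments. *)
Lemma Pas_root_moments B :
  (forall mu, @dual_mean R k E mu -> summing 1 (fun x => moment mu p x `^ p^-1) B) ->
  Pas (p / n.+1%:R) p n.+1 E F `<=` Pas (1 / n.+1%:R) 1 n.+1 E F.
Proof.
move=> hB P PP; have [hP cP _] := PP; split => //.
have [C C0 sP] := Pas_summing p_gt0 (ltn0Sn n) PP.
have homP := pos_homogeneous_polynomial p (ltn0Sn n) hP.
suff s1 : summing 1 (fun x => rnorm (P x) `^ (1 / n.+1%:R)) ((2 * C) `^ p^-1 * B).
  move=> x wx; have [W hW] := summing_sequence (lexx _) s1 wx.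
  exact: bounded_abs_summable hW.
move=> xs W wxs.
have [mu hmu dom] :=
  finite_domination p_gt0 C0 (fun=> powR_ge0 _ _) homP sP xs.
rewrite -mulrA; apply: (@le_trans _ _ ((2 * C) `^ p^-1 *
    \sum_(x <- xs) moment mu p x `^ p^-1)); last first.
  by rewrite ler_wpM2l ?powR_ge0//; exact: hB.
rewrite mulr_sumr !big_seq; apply: ler_sum => x xxs.
have -> : 1 / n.+1%:R = p / n.+1%:R * p^-1 by field; rewrite nat1r pnatr_eq0 gt_eqF.
rewrite powRrM -powRM ?mulr_ge0 ?moment_ge0 ?(ltW C0)//.
by rewrite ge0_ler_powR ?nnegrE ?powR_ge0 ?invr_ge0 ?mulr_ge0 ?moment_ge0
  ?(ltW C0) ?(ltW p_gt0) ?dom.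
Qed.

(** The inclusion theorem for dominated polynomials: a mean dominating [P] with
    exponent 1 dominates it with exponent [p], by Jensen's inequality. *)
Lemma Pas1_subset :
  Pas (1 / n.+1%:R) 1 n.+1 E F `<=` Pas (p / n.+1%:R) p n.+1 E F.
Proof.
move=> P PP; have [hP cP _] := PP; split => //.
have [C C0 sP] := Pas_summing ltr01 (ltn0Sn n) PP.
have homP := pos_homogeneous_polynomial 1 (ltn0Sn n) hP.
suff s1 : summing p (fun x => rnorm (P x) `^ (p / n.+1%:R)) ((2 * C) `^ p).
  move=> x wx; have [W hW] := summing_sequence p_ge1 s1 wx.
  exact: bounded_abs_summable hW.
move=> xs W wxs.
have [mu hmu dom] :=
  finite_domination ltr01 C0 (fun=> powR_ge0 _ _) homP sP xs.
apply: (@le_trans _ _ ((2 * C) `^ p * \sum_(x <- xs) moment mu p x)); last first.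
  by rewrite ler_wpM2l ?powR_ge0//; exact: (moment_sum (h := id) hmu).
rewrite mulr_sumr !big_seq; apply: ler_sum => x xxs.
have -> : p / n.+1%:R = 1 / n.+1%:R * p by rewrite mulrAC mul1r.
rewrite powRrM; apply: (@le_trans _ _ ((2 * C * moment mu 1 x) `^ p)).
  by rewrite ge0_ler_powR ?nnegrE ?powR_ge0 ?mulr_ge0 ?moment_ge0 ?(ltW C0)
    ?(ltW p_gt0) ?dom.
rewrite powRM ?mulr_ge0 ?moment_ge0 ?(ltW C0)// ler_wpM2l ?powR_ge0//.
apply: le_trans (mean_powR_le hmu p_ge1 (fun f => powR_ge0 _ _)) _.
by apply: (mean_le hmu) => f _; rewrite powRr1 ?rnorm_ge0.
Qed.

End Inclusions.

Theorem theorem14 (R : realType) (k : scalar_kind) (n : nat) (r p : R)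
    (n_ge1 : (1 <= n)%N) (r_gt1 : 1 < r) (r_lt_p : r < p)
    (X : completeNormedModType (scalars R k)) :
  let lpK : normedModType (scalars R k) := lp k (ltW (lt_trans r_gt1 r_lt_p)) in
  Pas (p / n%:R) p n X lpK = Pas (r / n%:R) r n X lpK ->
  forall Y : completeNormedModType (scalars R k),
    Pas (p / n%:R) p n X Y = Pas (1 / n%:R) 1 n X Y.
Proof.
move=> lpK coincidence Y.
case: n n_ge1 coincidence => // m _ coincidence.
have p1 : 1 < p := lt_trans r_gt1 r_lt_p.
have r0 : 0 < r := lt_trans ltr01 r_gt1.
have sub : Pas (p / m.+1%:R) p m.+1 X lpK `<=` Pas (r / m.+1%:R) r m.+1 X lpK.
  by rewrite coincidence.
have [C C0 hC] := moments_summing r0 r_lt_p sub.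
have [B hB] := root_moments_summing r_gt1 r_lt_p C0 hC.
apply/seteqP; split; last exact: Pas1_subset (ltW p1).
exact: (Pas_root_moments (ltW p1) hB).
Qed.
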